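(* Let $A=(A_{ijk})$ be a constant rank-3 tensor, symmetric in its first two indices, and let $\mathbf{u}_h=\mathbf{u}_h(\mathbf{x},t)\in\mathcal{U}_h^N$ be the solution of $$\int_\Omega\partial_t\mathbf{u}_h\cdot\boldsymbol{\phi}_h\,d\mathbf{x}+\int_\Omega(A:\nabla\tilde{\mathbf{w}}_h)\cdot\boldsymbol{\phi}_h\,d\mathbf{x}=0\qquad\forall\,\boldsymbol{\phi}_h\in\mathcal{U}_h^N,$$ where $\tilde{\mathbf{w}}_h=\mathbf{\Pi}_h\mathbf{u}_h$ is the $L^2$ projection of $\mathbf{u}_h$ onto $\mathcal{W}_h^{N+1}$. Assume periodic or vanishing boundary conditions. Then $\tilde{\mathbf{w}}_h$ satisfies the energy conservation $$\frac12\,\partial_t\|\tilde{\mathbf{w}}_h\|^2=0 .$$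
   Context: $\Omega\subset\mathbb{R}^d$ is a bounded computational domain partitioned by a conforming mesh $\mathcal{T}_h$ of non-overlapping simplices. For an integer $N\ge0$, $\mathcal{U}_h^N$ is the space of (vector-valued) discontinuous piecewise polynomials of degree at most $N$ on $\mathcal{T}_h$ and $\mathcal{W}_h^{N+1}$ the space of (vector-valued) globally continuous piecewise polynomials of degree at most $N+1$. The scheme discretizes the linear symmetric hyperbolic system $\partial_tq_i+A_{ijk}\partial_kq_j=0$ (summation over repeated indices), with $A_{ijk}=A_{jik}$, and $(A:\nabla\mathbf{w})_i=A_{ijk}\partial_kw_j$. $\mathbf{\Pi}_h$ is the $L^2(\Omega)$-orthogonal projection onto $\mathcal{W}_h^{N+1}$. $\|\mathbf{q}\|=\left(\int_\Omega|\mathbf{q}|^2\,d\mathbf{x}\right)^{1/2}$. ''Periodic boundary conditions'' means $\Omega$ is a periodic box, with mesh and spaces periodic; ''vanishing boundary conditions'' means $\tilde{\mathbf{w}}_h(\cdot,t)=0$ on $\partial\Omega$ for all $t$. *)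

(* Defs.v *)
From HB Require Import structures.
From mathcomp Require Import all_boot all_order all_algebra.
(* The notations of mpoly clash with those of the analysis library. *)
From mathcomp Require Import -(notations) mpoly.
From mathcomp Require Import all_classical all_reals all_analysis.
Set Implicit Arguments.
Unset Strict Implicit.
Unset Printing Implicit Defensive.
Import Order.TTheory GRing.Theory Num.Theory.
Import numFieldNormedType.Exports.
Local Open Scope classical_set_scope.
Local Open Scope ring_scope.

Section LebesgueStep.
Context (R : realType) (n : nat).
Notation RT := (measurableTypeR R).
Variable mu : {sigma_finite_measure set (n.-tuple RT) -> \bar R}.

Definition tcons (p : RT * n.-tuple RT) : n.+1.-tuple RT := [tuple of p.1 :: p.2].

Lemma measurable_tcons : measurable_fun [set: _] tcons.
Proof. exact: measurable_cons. Qed.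

HB.instance Definition _ := isMeasurableFun.Build _ _ _ _ tcons measurable_tcons.

Definition lebesgue_step : set (n.+1.-tuple RT) -> \bar R :=
  pushforward (lebesgue_measure \x mu)%E tcons.

Let step0 : lebesgue_step set0 = 0%E.
Proof. by rewrite /lebesgue_step /pushforward preimage_set0 measure0. Qed.

Let step_ge0 A : (0 <= lebesgue_step A)%E.
Proof. exact: measure_ge0. Qed.

Let step_sigma_additive : semi_sigma_additive lebesgue_step.
Proof. exact: (@measure_semi_sigma_additive _ _ _ (pushforward (lebesgue_measure \x mu)%E tcons)). Qed.

HB.instance Definition _ := isMeasure.Build _ _ _ lebesgue_step
  step0 step_ge0 step_sigma_additive.

Lemma tconsK_thead_behead (t : n.+1.-tuple RT) :
  tcons (thead t, [tuple of behead t]) = t.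
Proof. by rewrite /tcons /=; exact/esym/tuple_eta. Qed.

Let step_sigma_finite : sigma_finite [set: _] lebesgue_step.
Proof.
pose leb : {sigma_finite_measure set RT -> \bar R} := lebesgue_measure.
have /sigma_finiteP[F [FT ndF Ffin]] := sigma_finiteT leb.
have /sigma_finiteP[G [GT ndG Gfin]] := sigma_finiteT mu.
pose split (t : n.+1.-tuple RT) := (thead t, [tuple of behead t]).
have splitK : cancel split tcons by move=> t; exact: tconsK_thead_behead.
have tconsK : cancel tcons split.
  case=> x t; rewrite /split /tcons /=; congr pair.
  by apply: val_inj.
have msplit : measurable_fun [set: _] split.
  apply/measurable_fun_pairP; split.
    rewrite (_ : _ \o _ = (@tnth _ _)^~ ord0) //; exact: measurable_tnth.
  exact: measurable_behead.
exists (fun k => split @^-1` (F k `*` G k)).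
  rewrite -preimage_bigcup (_ : \bigcup_k _ = setT) ?preimage_setT //.
  apply/seteqP; split=> // -[x t] _.
  have [i _ Fi] : (\bigcup_k F k) x by rewrite -FT.
  have [j _ Gj] : (\bigcup_k G k) t by rewrite -GT.
  exists (maxn i j) => //; split => /=.
    by move: x Fi; exact/subsetPset/ndF/leq_maxl.
  by move: t Gj; exact/subsetPset/ndG/leq_maxr.
move=> k; have [mFk Fk] := Ffin k; have [mGk Gk] := Gfin k.
have mFG : measurable (F k `*` G k) by exact: measurableX.
split; first by rewrite -[X in measurable X]setTI; exact: msplit.
rewrite /lebesgue_step /pushforward -comp_preimage.
rewrite (_ : split \o tcons = id) ?preimage_id; last first.
  by apply/funext => p /=; exact: tconsK.
by rewrite product_measure1E// lte_mul_pinfty// ge0_fin_numE.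
Qed.

HB.instance Definition _ := Measure_isSigmaFinite.Build _ _ _ lebesgue_step
  step_sigma_finite.

End LebesgueStep.

Fixpoint lebesgue_tuple (R : realType) (d : nat) :
    {sigma_finite_measure set (d.-tuple (measurableTypeR R)) -> \bar R} :=
  match d with
  | 0 => @dirac _ _ [tuple] R
  | d'.+1 => lebesgue_step (lebesgue_tuple R d')
  end.

Lemma lebesgue_tuple_box (R : realType) (d : nat)
    (B : 'I_d -> set (measurableTypeR R)) :
  (forall k, measurable (B k)) ->
  lebesgue_tuple R d [set t | forall k, B k (tnth t k)] =
  (\prod_(k < d) lebesgue_measure (B k))%E.
Proof.
elim: d B => [|d IHd] B mB.
  by rewrite big_ord0 /= diracE mem_set// => -[].
rewrite big_ord_recl -IHd //=.
rewrite /lebesgue_step /pushforward.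
rewrite -product_measure1E //; last first.
  rewrite (_ : mkset _ = \bigcap_(k in [set: 'I_d])
      ((fun t => tnth t k) @^-1` B (lift ord0 k))).
    apply: fin_bigcap_measurable => [|k _]; first exact: finite_finset.
    by rewrite -[X in measurable X]setTI; exact: measurable_tnth.
  by apply/seteqP; split => t /= h k; [move=> _; exact: h | exact: (h k I)].
congr (_ _); apply/seteqP; split=> -[x t] /=.
  by move=> h; split=> [|k]; [have := h ord0 | have := h (lift ord0 k); rewrite /tcons tnthS].
by case=> h0 h k; case: (unliftP ord0 k) => [j|] ->; rewrite /tcons ?tnthS.
Qed.

Section FiniteElements.
Context (R : realType) (d : nat).
Implicit Types (D Omega Lambda : set 'rV[R]_d) (V : 'M[R]_(d.+1, d)).

(* The Lebesgue measure lives on tuples, the topology on row vectors; an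
   integral over D is read through the coordinate identification. *)
Definition rv_of_tuple (t : d.-tuple (measurableTypeR R)) : 'rV[R]_d :=
  \row_k (tnth t k : R).

Definition integral_Rd D (f : 'rV[R]_d -> R) : R :=
  \int[lebesgue_tuple R d]_(t in rv_of_tuple @^-1` D) f (rv_of_tuple t).

Definition boundary Omega := closure Omega `\` interior Omega.

(* Rows of V are vertices; the face spanned by the vertices in S is their
   convex hull, so the empty face is set0. *)
Definition face V (S : {set 'I_d.+1}) : set 'rV[R]_d :=
  [set x | exists l : 'rV[R]_d.+1,
    [/\ forall i, 0 <= l 0 i, \sum_i l 0 i = 1,
        forall i, i \notin S -> l 0 i = 0 & x = l *m V]].

Definition simplex V : set 'rV[R]_d := face V [set: 'I_d.+1]%SET.

(* The rows (v_i, 1) are linearly independent. *)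
Definition affinely_independent V : bool :=
  row_free (row_mx V (const_mx 1 : 'cV[R]_d.+1)).

Definition translate (tau : 'rV[R]_d) D : set 'rV[R]_d :=
  (fun x => x + tau) @` D.

(* Lambda is the group of translations along which points of the closure of
   Omega are identified: [set 0] without periodicity, the lattice of periods
   for a periodic box. Conformity is required of all translated copies, i.e.
   of the Lambda-periodic extension of the mesh. *)
Record conforming_mesh Omega Lambda (n : nat) (T : 'I_n -> 'M[R]_(d.+1, d)) :
    Prop := {
  mesh_nondegenerate : forall K, affinely_independent (T K);
  mesh_cover : closure Omega = \bigcup_K simplex (T K);
  mesh_inside : forall K, interior (simplex (T K)) `<=` Omega;
  mesh_nonoverlapping : forall K L, K != L ->
    interior (simplex (T K)) `&` interior (simplex (T L)) = set0;
  mesh_conforming : forall K L tau, Lambda tau ->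
    exists S S' : {set 'I_d.+1},
      simplex (T K) `&` translate tau (simplex (T L)) = face (T K) S /\
      face (T K) S = translate tau (face (T L) S') }.

Definition open_box (a b : 'rV[R]_d) : set 'rV[R]_d :=
  [set x | forall k, a 0 k < x 0 k < b 0 k].

Definition period_lattice (a b : 'rV[R]_d) : set 'rV[R]_d :=
  [set tau | exists z : 'I_d -> int,
    forall k, tau 0 k = (z k)%:~R * (b 0 k - a 0 k)].

Definition periodic_box Omega Lambda : Prop :=
  exists a b : 'rV[R]_d, [/\ forall k, a 0 k < b 0 k,
    Omega = open_box a b & Lambda = period_lattice a b].

Section Fields.
Context (m n : nat) (T : 'I_n -> 'M[R]_(d.+1, d)).
Implicit Types (u v w : 'rV[R]_d -> 'rV[R]_m).

(* [mpoly.msize p] is the total degree plus one. *)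
Definition polynomial_on (N : nat) D u : Prop :=
  forall j : 'I_m, exists2 p : mpoly.mpoly d R,
    (mpoly.msize p <= N.+1)%N &
    forall x, D x -> u x 0 j = mpoly.meval (x 0) p.

(* Values on the mesh skeleton, a null set, are left arbitrary. *)
Definition dg_space (N : nat) : set ('rV[R]_d -> 'rV[R]_m) :=
  [set u | forall K, polynomial_on N (interior (simplex (T K))) u].

Definition cg_space Omega Lambda (N : nat) : set ('rV[R]_d -> 'rV[R]_m) :=
  [set w | [/\ {within closure Omega, continuous w},
    forall K, polynomial_on N (simplex (T K)) w &
    forall x tau, Lambda tau -> closure Omega x -> closure Omega (x + tau) ->
      w (x + tau) = w x]].

Definition L2_inner Omega u v : R :=
  integral_Rd Omega (fun x => \sum_(i < m) u x 0 i * v x 0 i).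

Definition L2_norm Omega u : R := Num.sqrt (L2_inner Omega u u).

Definition is_L2_projection Omega (W : set ('rV[R]_d -> 'rV[R]_m)) u w : Prop :=
  W w /\ forall v, W v -> L2_inner Omega (fun x => u x - w x) v = 0.

Definition partial (k : 'I_d) (f : 'rV[R]_d -> R) : 'rV[R]_d -> R :=
  fun x => 'D_(delta_mx 0 k) f x.

Definition A_grad (A : 'I_m -> 'I_m -> 'I_d -> R) w : 'rV[R]_d -> 'rV[R]_m :=
  fun x => \row_i \sum_j \sum_k A i j k * partial k (fun y => w y 0 j) x.

Definition time_derivative (u : R -> 'rV[R]_d -> 'rV[R]_m) (t : R) :
    'rV[R]_d -> 'rV[R]_m := fun x => derive1 (fun s => u s x) t.

(* Spatial and temporal derivatives are only meaningful off the skeleton. *)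
Record semidiscrete_solution (A : 'I_m -> 'I_m -> 'I_d -> R) Omega (N : nat)
    (J : set R) (u w : R -> 'rV[R]_d -> 'rV[R]_m) : Prop := {
  solution_space : forall t, J t -> dg_space N (u t);
  solution_derivable : forall t, J t -> forall K x,
    interior (simplex (T K)) x -> derivable (fun s => u s x) t 1;
  solution_weak_form : forall t, J t -> forall phi, dg_space N phi ->
    L2_inner Omega (time_derivative u t) phi +
    L2_inner Omega (A_grad A (w t)) phi = 0 }.

End Fields.
End FiniteElements.

(* Main.v *)
Require Import Defs.
From HB Require Import structures.
From mathcomp Require Import all_boot all_order all_algebra.
From mathcomp Require Import -(notations) mpoly.
From mathcomp Require Import all_classical all_reals all_analysis measurable_realfun.
From mathcomp Require Import ring lra.
Set Implicit Arguments.
Unset Strict Implicit.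
Unset Printing Implicit Defensive.
Import Order.TTheory GRing.Theory Num.Theory.
Import numFieldNormedType.Exports.
Local Open Scope classical_set_scope.
Local Open Scope ring_scope.

(** The residual r = d_t u + A:grad w lies in the space of test functions.
    Indeed A:grad w has degree N because w has degree N + 1, and d_t u has
    degree N because the test space is finite-dimensional away from the mesh
    skeleton: u is a combination of fixed fields whose coefficients are values
    of u at finitely many points ([dg_interpolation]), so differentiating in
    time differentiates the coefficients only.  Testing the scheme with r gives
    (r, r) = 0, hence (r, w) = 0 ([L2_inner_null]); this detour is what allows
    testing with w, whose degree N + 1 is too large for a test function.

    Next, (A:grad w, w) = 0 ([A_grad_inner_eq0]): by the symmetry of A it is
    half the integral of the derivatives d_k (A_ijk w_i w_j), and each of these
    integrates to zero under either boundary condition.  So (d_t u, w) = 0.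

    Finally, as w(s) is the projection of u(s) and w(t) is a legitimate test
    function for that projection,
      |w(s)|^2 - |w(t)|^2 = 2 (u(s) - u(t), w(t)) + |w(s) - w(t)|^2,
    and the last term is at most |u(s) - u(t)|^2, a quadratic form in the
    increments of the coefficients of u, because projections contract.  It is
    therefore o(s - t), and the energy is differentiable at t with derivative
    (d_t u, w) = 0 ([is_derive0_squeeze]); differentiability comes out of this
    expansion instead of being deduced from that of w.

    The vanishing of the integral of d_k f, for f continuous and polynomial on
    each simplex, is proved without a divergence theorem on simplices.  In both
    cases f (extended by zero outside the domain for vanishing boundary values)
    is a continuous function on a box that takes equal values at opposite points
    of the two faces orthogonal to direction k.  On a line in that direction f is continuous and
    Lipschitz on each of finitely many pieces, hence Lipschitz
    ([lipschitz_of_finite_cover]).  The difference quotients of its periodic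
    extension are thus bounded; they integrate to zero because Lebesgue measure
    is translation invariant, and they converge to d_k f off the hyperplanes
    spanned by the faces.  Dominated convergence concludes
    ([integral_partial_periodic_eq0]).

    Fields are arbitrary on the skeleton, so integrands over the domain may fail
    to be measurable; [integral_off_null] shows that such values never matter,
    and every integral is computed over the union of the open simplices. *)

(** * Lebesgue measure on tuples *)

Section IntegralOffNullSet.
Context dp (X : measurableType dp) (R : realType).
Variable mu : {measure set X -> \bar R}.
Import HBNNSimple.

(** A simple function below f, once cut off on N, is a simple function below g
    with the same integral. *)
Let ge0_integral_off_null_le (N : set X) (f g : X -> \bar R) :
  measurable N -> mu N = 0%E ->
  (forall x, (0 <= f x)%E) -> (forall x, (0 <= g x)%E) ->
  (forall x, ~ N x -> f x = g x) ->
  (\int[mu]_x f x <= \int[mu]_x g x)%E.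
Proof.
move=> mN N0 f0 g0 fg.
rewrite (ge0_integralTE _ f0) (ge0_integralTE _ g0).
apply: ge_ereal_sup => _ /= [h hf <-].
pose h' := mul_nnsfun h (indic_nnsfun R (measurableC mN)).
have -> : sintegral mu h = sintegral mu h'.
  rewrite -!integralT_nnsfun; apply: ae_eq_integral => //.
  - exact/measurable_EFinP.
  - exact/measurable_EFinP.
  - exists N; split=> // x; apply: contra_notP => nNx _.
    by rewrite /h' /= mindicE mem_set //= mulr1.
apply: ereal_sup_ubound; exists h' => //= x; rewrite mindicE.
case: (pselect (N x)) => Nx.
  by rewrite memNset ?mulr0// => nN; exact: nN.
by rewrite mem_set //= mulr1 -fg.
Qed.

(** The functions are arbitrary: the integral is a supremum over simple functions
    below the integrand, a definition that is meaningful without measurability. *)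
Lemma integral_off_null (N : set X) (f g : X -> \bar R) :
  measurable N -> mu N = 0%E -> (forall x, ~ N x -> f x = g x) ->
  (\int[mu]_x f x = \int[mu]_x g x)%E.
Proof.
move=> mN N0 fg; rewrite integralE [RHS]integralE.
by congr (_ - _)%E; apply/eqP; rewrite eq_le; apply/andP; split;
  apply: (@ge0_integral_off_null_le N) => //= x Nx; rewrite ?funeposE ?funenegE ?fg.
Qed.

Lemma Rintegral_off_null (N D E : set X) (f g : X -> R) :
  measurable N -> mu N = 0%E ->
  (forall x, ~ N x -> (f \_ D) x = (g \_ E) x) ->
  \int[mu]_(x in D) f x = \int[mu]_(x in E) g x.
Proof.
move=> mN N0 fg; rewrite Rintegral_mkcond [RHS]Rintegral_mkcond /Rintegral.
by congr fine; apply: (@integral_off_null N) => // x Nx; rewrite fg.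
Qed.

End IntegralOffNullSet.

Section LebesgueTuple.
Context (R : realType).
Notation RT := (measurableTypeR R).

Lemma lebesgue_measure_translate (c : R) (A : set RT) : measurable A ->
  lebesgue_measure ((fun x : RT => x + c : RT) @^-1` A) = lebesgue_measure A.
Proof.
move=> mA.
have mc : measurable_fun setT (fun x : RT => x + c : RT).
  by apply: measurable_funD => //; exact: measurable_cst.
rewrite -[LHS]/(pushforward lebesgue_measure (fun x : RT => x + c : RT) A).
apply/esym/lebesgue_measure_unique => //= _ [[a b]] _ <-.
rewrite /pushforward.
rewrite (_ : _ @^-1` _ = `]a - c, b - c]%classic); last first.
  by apply/seteqP; split=> x /=; rewrite !in_itv /= ltrBlDr lerBrDr.
rewrite !lebesgue_measure_itv /= !lte_fin ltrD2r.
by case: ifP => // _; rewrite -!EFinB; congr EFin; rewrite opprB addrA subrK.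
Qed.

Definition tuple_shift d (tau : 'I_d -> R) (t : d.-tuple RT) : d.-tuple RT :=
  [tuple (tnth t k + tau k : RT) | k < d].

Lemma measurable_tuple_shift d (tau : 'I_d -> R) :
  measurable_fun setT (tuple_shift tau).
Proof.
apply/measurable_fun_tnthP => k.
rewrite (_ : _ \o _ = (fun t => (tnth t k : RT) + tau k)); last first.
  by apply/funext => t /=; rewrite tnth_mktuple.
by apply: measurable_funD; [exact: measurable_tnth | exact: measurable_cst].
Qed.

(** By induction on the dimension: the measure of a set is the integral of the
    measures of its slices, and both the slices and the integral over the first
    coordinate are translation invariant. *)
Lemma lebesgue_tuple_translate d (tau : 'I_d -> R) A : measurable A ->
  lebesgue_tuple R d (tuple_shift tau @^-1` A) = lebesgue_tuple R d A.
Proof.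
elim: d tau A => [|d IHd] tau A mA.
  by congr (_ _); apply/seteqP; split => t /=; rewrite [tuple_shift tau t]tuple0 (tuple0 t).
pose B := @tcons R d @^-1` A.
have mB : measurable B.
  by rewrite -[X in measurable X]setTI; exact: measurable_tcons.
rewrite /= /lebesgue_step /pushforward /product_measure1 -/B.
pose tau' k := tau (lift ord0 k).
pose c (x : RT) : RT := x + tau ord0.
transitivity (\int[lebesgue_measure]_(x in setT)
    ((lebesgue_tuple R d \o xsection B) \o c) x)%E.
  apply: eq_integral => x _ /=; rewrite -[RHS](IHd tau'); last exact: measurable_xsection.
  congr (_ _); apply/seteqP; split => t; rewrite /xsection /B /= !inE /=;
    congr A; apply/eq_from_tnth => k; rewrite tnth_mktuple;
    case: (unliftP ord0 k) => [j|] ->; by rewrite /tcons ?tnthS //= ?tnth_mktuple.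
have m0 : measurable_fun setT c.
  by apply: measurable_funD => //; exact: measurable_cst.
have mF := measurable_fun_xsection (lebesgue_tuple R d) mB.
rewrite -[X in (\int[_]_(x in X) _)%E](preimage_setT c).
rewrite -ge0_integral_pushforward //.
apply: eq_measure_integral => C mC _; exact: lebesgue_measure_translate.
Qed.

Definition affine_zeros d (a : 'I_d -> R) (c : R) : set (d.-tuple RT) :=
  [set t | \sum_k a k * (tnth t k : R) + c = 0].

Lemma measurable_affine d (a : 'I_d -> R) (c : R) :
  measurable_fun setT (fun t : d.-tuple RT => \sum_k a k * (tnth t k : R) + c).
Proof.
apply: measurable_funD; last exact: measurable_cst.
apply: measurable_sum => k; apply: measurable_funM; first exact: measurable_cst.
exact: measurable_tnth.
Qed.

Lemma measurable_affine_zeros d (a : 'I_d -> R) c : measurable (affine_zeros a c).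
Proof.
rewrite (_ : affine_zeros a c =
  (fun t : d.-tuple RT => \sum_k a k * (tnth t k : R) + c) @^-1` [set 0]) //.
rewrite -[X in measurable X]setTI; apply: measurable_affine => //.
Qed.

(** If the first coordinate has a nonzero coefficient, every slice along it is a
    single point; otherwise every slice across it is a set of the same kind in one
    dimension less. *)
Lemma affine_zeros_null d (a : 'I_d -> R) c :
  (c = 0 -> exists k, a k != 0) -> lebesgue_tuple R d (affine_zeros a c) = 0%E.
Proof.
elim: d a c => [|d IHd] a c ac0.
  rewrite (_ : affine_zeros a c = set0) ?measure0//; apply/seteqP; split=> // t.
  by rewrite /affine_zeros /= big_ord0 add0r => /ac0 [[]].
rewrite /= /lebesgue_step /pushforward.
set B := _ @^-1` _.
have mB : measurable B.
  by rewrite -[X in measurable X]setTI; apply: measurable_tcons => //;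
     exact: measurable_affine_zeros.
have BE x t : B (x, t) =
    (a ord0 * x + (\sum_k a (lift ord0 k) * (tnth t k : R) + c) = 0).
  rewrite /B /affine_zeros /= big_ord_recl addrA /tcons; congr (_ + _ + _ = _).
  by apply: eq_bigr => k _; rewrite tnthS.
have [a0|a0] := eqVneq (a ord0) 0.
  rewrite /product_measure1 integral0_eq // => x _ /=.
  rewrite (_ : xsection B x = affine_zeros (fun k => a (lift ord0 k)) c).
    apply: IHd => /ac0 [k]; case: (unliftP ord0 k) => [j|] ->; last by rewrite a0 eqxx.
    by exists j.
  by apply/seteqP; split => t; rewrite /xsection /= inE BE a0 mul0r add0r.
rewrite (@product_measure_unique _ _ _ _ _ lebesgue_measure (lebesgue_tuple R d)
  (lebesgue_measure \x^ lebesgue_tuple R d)%E) //; last first.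
  by move=> C D mC mD; exact: product_measure2E.
rewrite [LHS]integral0_eq // => t _ /=.
have -> : ysection B t =
    [set (- (\sum_k a (lift ord0 k) * (tnth t k : R) + c) / a ord0 : RT)].
  apply/seteqP; split => x; rewrite /ysection /= inE BE.
    by move=> /eqP; rewrite addr_eq0 => /eqP <-; rewrite mulrC mulKf.
  by move=> ->; rewrite mulrC divfK // addNr.
exact: lebesgue_measure_set1.
Qed.

(** The sigma-algebra on tuples is generated by the coordinates whereas open sets
    of row vectors come from the norm: an open set is the union of the countably
    many rational cubes that it contains. *)
Lemma measurable_open_rv d (U : set 'rV[R]_d) : open U ->
  measurable (@rv_of_tuple R d @^-1` U).
Proof.
move=> oU.
pose box (qr : 'rV[rat]_d * rat) : set (d.-tuple RT) :=
  [set t | forall k, ball (ratr (qr.1 0 k) : R) (ratr qr.2) (tnth t k : R)].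
pose Q := [set qr : 'rV[rat]_d * rat | box qr `<=` @rv_of_tuple R d @^-1` U].
have -> : @rv_of_tuple R d @^-1` U = \bigcup_(qr in Q) box qr.
  apply/seteqP; split => [t /= Ut|t [qr Qqr /Qqr //]].
  have : nbhs (rv_of_tuple t) U by apply: open_nbhs_nbhs; split.
  move=> /(@nbhs_ballP R) [e e0 eU].
  have [r /andP[r0 re]] : exists r : rat, 0 < (ratr r : R) < e / 2.
    have /rat_in_itvoo[r re] : 0 < e / 2 by rewrite divr_gt0.
    by exists r; move: re; rewrite in_itv.
  have [q hq] : exists q : 'rV[rat]_d,
      forall k, ball (ratr (q 0 k) : R) (ratr r) (tnth t k : R).
    have H k : exists q : rat, ball (tnth t k : R) (ratr r) (ratr q : R).
      have := @dense_rat R (ball (tnth t k : R) (ratr r)).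
      case=> [||x [xb [q _ qx]]].
      - by exists (tnth t k); exact: ballxx.
      - exact: ball_open.
      by exists q; rewrite qx.
    have [q hq] := choice H.
    by exists (\row_k q k) => k; rewrite mxE; apply: ball_sym.
  exists (q, r) => //= s hs; apply: eU; split=> // i j; rewrite (ord1 i) !mxE.
  apply: (@le_ball _ _ _ (ratr r + ratr r)).
    by rewrite [leRHS]splitr lerD // ltW.
  by apply: ball_triangle (hs j); apply: ball_sym; exact: hq.
rewrite bigcup_mkcond; apply: countable_bigcupT_measurable => // qr.
case: ifPn => // _.
rewrite (_ : box qr = \bigcap_(k in [set: 'I_d])
  ((fun t => tnth t k) @^-1` ball (ratr (qr.1 0 k) : R) (ratr qr.2))).
  apply: fin_bigcap_measurable => [|k _]; first exact: finite_finset.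
  rewrite -[X in measurable X]setTI; apply: measurable_tnth => //.
  exact: measurable_ball.
by apply/seteqP; split => t /= h k; [move=> _; exact: h | exact: (h k I)].
Qed.

Lemma within_continuous_measurable_rv d (D : set 'rV[R]_d) (f : 'rV[R]_d -> R) :
  measurable (@rv_of_tuple R d @^-1` D) -> {within D, continuous f} ->
  measurable_fun (@rv_of_tuple R d @^-1` D) (f \o @rv_of_tuple R d).
Proof.
move=> mD /continuousP cf.
apply: (measurability _ (RGenOpens.measurableE R)) => _ [_ [a [b ->] <-]].
have /open_subspaceP [V oV VD] : open (from_subspace D f @^-1` `]a, b[%classic).
  exact/cf/interval_open.
rewrite comp_preimage setIC
  -[X in measurable X]/(rv_of_tuple (d:=d) @^-1` (f @^-1` `]a, b[ `&` D)) -VD preimage_setI.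
by apply: measurableI => //; exact: measurable_open_rv.
Qed.

End LebesgueTuple.

(** * Polynomial functions *)

Section PolynomialFunctions.
Context (R : realType) (d : nat).
Notation poly := (mpoly.mpoly d R).
Implicit Types (p q : poly) (x y : 'rV[R]_d).

Definition polyfun p x : R := mpoly.meval (x 0) p.

(** Polynomials are generated as a ring by constants and variables, so that an
    analytic property stable under sums and products holds for all of them. *)
Lemma mpoly_ring_ind (P : poly -> Prop) :
  (forall c, P (mpoly.mpolyC d c)) ->
  (forall k, P (mpoly.mpolyX R (mpoly.mnm1 k))) ->
  (forall p q, P p -> P q -> P (p + q)) ->
  (forall p q, P p -> P q -> P (p * q)) -> forall p, P p.
Proof.
move=> PC PX PD PM; elim/mpoly.mpolyind.
  by rewrite -mpoly.mpolyC0; exact: PC.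
move=> c m p _ _ Pp; apply: (PD) => //; rewrite -mpoly.mul_mpolyC.
apply: (PM) => //; rewrite mpoly.mpolyXE_id.
apply: (big_ind P) => [||k _]; [by rewrite -mpoly.mpolyC1; exact: PC | exact: PM |].
elim: (m k) => [|i IHi]; first by rewrite expr0 -mpoly.mpolyC1; exact: PC.
by rewrite exprS; apply: (PM).
Qed.

Lemma polyfunC c : polyfun (mpoly.mpolyC d c) = cst c.
Proof. by apply/funext => x; rewrite /polyfun mpoly.mevalC. Qed.

Lemma polyfunX k : polyfun (mpoly.mpolyX R (mpoly.mnm1 k)) = fun x => x 0 k.
Proof. by apply/funext => x; rewrite /polyfun mpoly.mevalXU. Qed.

Lemma polyfunD p q : polyfun (p + q) = polyfun p + polyfun q.
Proof. by apply/funext => x; rewrite /polyfun mpoly.mevalD. Qed.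

Lemma polyfunM p q : polyfun (p * q) = polyfun p * polyfun q.
Proof. by apply/funext => x; rewrite /polyfun mpoly.mevalM. Qed.

Lemma polyfun_sum (I : Type) (r : seq I) (P : pred I) (F : I -> poly) x :
  polyfun (\sum_(i <- r | P i) F i) x = \sum_(i <- r | P i) polyfun (F i) x.
Proof.
apply: (big_morph (fun p => polyfun p x)) => [p q|]; first by rewrite polyfunD.
by rewrite -mpoly.mpolyC0 polyfunC.
Qed.

Lemma msize_sum_le (I : Type) (r : seq I) (P : pred I) (F : I -> poly) N :
  (forall i, P i -> (mpoly.msize (F i) <= N)%N) ->
  (mpoly.msize (\sum_(i <- r | P i) F i) <= N)%N.
Proof.
move=> FN; apply: (big_ind (fun p : poly => (mpoly.msize p <= N)%N)) => //.
  by rewrite mpoly.mmeasure0.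
move=> p q pN qN; apply: leq_trans (mpoly.mmeasureD_le _ _ _) _.
by rewrite geq_max pN.
Qed.

Lemma continuous_polyfun p : continuous (polyfun p).
Proof.
elim/mpoly_ring_ind: p => [c|k|p q cp cq|p q cp cq] x.
- rewrite polyfunC; exact: cst_continuous.
- rewrite polyfunX; exact: coord_continuous.
- by rewrite polyfunD; exact: (continuousD (cp x) (cq x)).
- by rewrite polyfunM; exact: (continuousM (cp x) (cq x)).
Qed.

Lemma measurable_polyfun p : measurable_fun setT (polyfun p \o @rv_of_tuple R d).
Proof.
have := @within_continuous_measurable_rv R d setT (polyfun p).
rewrite preimage_setT; apply=> //.
by apply: continuous_subspaceT => x; exact: continuous_polyfun.
Qed.

Lemma is_derive_polyfun p k x :
  is_derive x (delta_mx 0 k) (polyfun p) (polyfun (mpoly.mderiv k p) x).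
Proof.
elim/mpoly_ring_ind: p => [c|j|p q dp dq|p q dp dq].
- by rewrite mpoly.mderivC -mpoly.mpolyC0 !polyfunC; exact: is_derive_cst.
- apply: (is_derive_eq (f' := (delta_mx 0 k : 'rV[R]_d) 0 j)).
    have @f : {linear 'rV[R]_d -> R}.
      by exists (fun x : 'rV[R]_d => x 0 j); do 2![eexists]; do ?[constructor];
        rewrite ?mxE// => ? *; rewrite ?mxE//; move=> ?; rewrite !mxE.
    have cf : continuous f by exact: coord_continuous.
    rewrite polyfunX (_ : (fun _ => _) = f) //; apply: DeriveDef.
      by apply: diff_derivable; exact: linear_differentiable.
    by rewrite deriveE ?diff_lin //; exact: linear_differentiable.
  rewrite mpoly.mderivX mpoly.mnm1E mxE /= /polyfun mpoly.mevalZ.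
  have [->|_] := eqVneq j k; last by rewrite mul0r.
  by rewrite mpoly.mevalX big1 ?mulr1 // => i _; rewrite mpoly.mnmBE subnn expr0.
- by rewrite mpoly.mderivD !polyfunD; exact: is_deriveD.
- rewrite mpoly.mderivM !polyfunD !polyfunM.
  apply: is_derive_eq; rewrite addrC /=; congr (_ + _); exact: mulrC.
Qed.

Lemma msize_mderiv_le p k : (mpoly.msize (mpoly.mderiv k p) <= (mpoly.msize p).-1)%N.
Proof.
rewrite mpoly.msizeE big_seq; apply/bigmax_leqP_seq => m + _.
rewrite mpoly.mcoeff_msupp mpoly.mcoeff_mderiv => h.
have : mpoly.mnm_add m (mpoly.mnm1 k) \in mpoly.msupp p.
  by rewrite mpoly.mcoeff_msupp; apply: contra h => /eqP ->; rewrite mul0rn.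
move/mpoly.msize_mdeg_lt; rewrite mpoly.mdegD mpoly.mdeg1 addn1.
by case: (mpoly.msize p).
Qed.

Lemma le_coord_norm x k : `|x 0 k| <= `|x|.
Proof.
rewrite /Num.Def.normr /= mx_normrE.
exact: (le_bigmax _ (fun i : 'I_1 * 'I_d => `|x i.1 i.2|) (0, k)).
Qed.

Definition lipschitz_with (S : set 'rV[R]_d) (f : 'rV[R]_d -> R) (L : R) :=
  forall x y, S x -> S y -> `|f x - f y| <= L * `|x - y|.

(** Boundedness and the Lipschitz property must be proved together, since the
    Lipschitz constant of a product involves the bounds of the factors. *)
Lemma bounded_lipschitz_polyfun p (S : set 'rV[R]_d) : bounded_set S ->
  exists2 C, (forall x, S x -> `|polyfun p x| <= C) & lipschitz_with S (polyfun p) C.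
Proof.
move=> [B0 [_ bS]]; pose B := `|B0| + 1.
have bdS x : S x -> `|x| <= B.
  by apply: bS; rewrite (le_lt_trans (ler_norm _)) ?ltrDl.
suff : exists C, 0 <= C /\ ((forall x, S x -> `|polyfun p x| <= C) /\
  lipschitz_with S (polyfun p) C) by move=> [C [_ []]]; exists C.
elim/mpoly_ring_ind: p => [c|k|p q [C [C0 [bp lp]]] [D [D0 [bq lq]]]
    |p q [C [C0 [bp lp]]] [D [D0 [bq lq]]]].
- exists `|c|; split => //; split=> [x Sx|x y Sx Sy]; rewrite polyfunC //=.
  by rewrite subrr normr0 mulr_ge0.
- exists (B + 1); split; first by rewrite !addr_ge0.
  split=> [x Sx|x y Sx Sy]; rewrite polyfunX.
    by rewrite (le_trans (le_coord_norm _ _)) // (le_trans (bdS _ Sx)) // lerDl.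
  have -> : x 0 k - y 0 k = (x - y) 0 k by rewrite !mxE.
  rewrite (le_trans (le_coord_norm _ _)) // ler_peMl // lerDr.
  by rewrite addr_ge0.
- exists (C + D); split; first by rewrite addr_ge0.
  split=> [x Sx|x y Sx Sy]; rewrite polyfunD.
    by rewrite (le_trans (ler_normD _ _)) // lerD // ?bp ?bq.
  rewrite /= opprD addrACA mulrDl (le_trans (ler_normD _ _)) // lerD //.
    exact: lp.
  exact: lq.
- have CD0 : 0 <= C * D by rewrite mulr_ge0.
  exists (C * D *+ 2); split; first by rewrite mulrn_wge0.
  split=> [x Sx|x y Sx Sy]; rewrite polyfunM /=.
    rewrite normrM (@le_trans _ _ (C * D)) //.
      by apply: ler_pM => //; [exact: bp|exact: bq].
    by rewrite mulr2n lerDl.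
  have -> : polyfun p x * polyfun q x - polyfun p y * polyfun q y =
     (polyfun p x - polyfun p y) * polyfun q x + polyfun p y * (polyfun q x - polyfun q y).
    by ring.
  rewrite (le_trans (ler_normD _ _)) // !normrM mulr2n mulrDl lerD //.
    rewrite -mulrA (mulrC D) mulrA; apply: ler_pM => //; [exact: lp|exact: bq].
  rewrite -mulrA; apply: ler_pM => //; [exact: bp|exact: lq].
Qed.

End PolynomialFunctions.

(** * Continuous functions that are Lipschitz on finitely many pieces *)

Section LipschitzPieces.
Context (R : realType).

(** Let c be the supremum of the points that share a piece with a.  The bound
    holds from a to c by continuity, and that piece does not meet the interval
    beyond c, which is thus covered by fewer pieces: induction on their number. *)
Lemma lipschitz_of_finite_cover (I : finType) (C : I -> set R) (g : R -> R) (L a b : R) :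
  a <= b ->
  (forall x, a <= x <= b -> forall e, 0 < e -> exists2 del, 0 < del &
    forall y, a <= y <= b -> `|x - y| < del -> `|g x - g y| < e) ->
  (forall x, a <= x <= b -> exists i, C i x) ->
  (forall i x y, C i x -> C i y -> `|g x - g y| <= L * `|x - y|) ->
  0 <= L -> `|g b - g a| <= L * (b - a).
Proof.
move=> ab cg cov lip L0.
suff H (A : {set I}) a' : a <= a' <= b ->
    (forall x, a' <= x <= b -> exists2 i, i \in A & C i x) ->
    `|g b - g a'| <= L * (b - a').
  apply: (H [set: I]%SET); rewrite ?lexx ?ab // => x /cov [i Ci].
  by exists i.
move: {2}#|A| (leqnn #|A|) => k; elim: k A a' => [|k IHk] A a' leA /andP[aa' a'b] covA.
  have [|i iA _] := covA a'; first by rewrite lexx.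
  by move: leA; rewrite leqn0 cards_eq0 => /eqP A0; rewrite A0 inE in iA.
have [|i iA Cia'] := covA a'; first by rewrite lexx.
pose S := [set x | a' <= x <= b /\ C i x].
have Sa' : S a' by split; rewrite ?lexx.
have hS : has_sup S by split; [exists a' | exists b => x [/andP[]]].
pose c := sup S.
have a'c : a' <= c by apply: ub_le_sup => //; case: hS.
have cb : c <= b by apply: ge_sup => [|x [/andP[]//]]; exists a'.
have cab : a <= c <= b by rewrite (le_trans aa' a'c).
(* c itself may lie outside the piece: continuity carries the bound over to it. *)
have gca : `|g c - g a'| <= L * (c - a').
  apply/ler_addgt0Pr => e e0; have [del del0 hdel] := cg c cab e e0.
  have [x [/andP[a'x xb] Cix] cx] := sup_adherent del0 hS.
  have xc : x <= c by apply: ub_le_sup; [case: hS | split=> //; exact/andP].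
  rewrite (le_trans (ler_distD (g x) _ _)) // addrC lerD //.
    rewrite (le_trans (lip i _ _ Cix Cia')) // ger0_norm ?subr_ge0 //.
    by rewrite ler_wpM2l // lerD2r.
  apply/ltW/hdel; first by rewrite (le_trans aa' a'x) xb.
  by rewrite ger0_norm ?subr_ge0 // ltrBlDr -ltrBlDl.
have [cb'|cb'] := eqVneq c b; first by rewrite -cb'.
have {cb'} ltcb : c < b by rewrite lt_neqAle cb'.
have gbc : `|g b - g c| <= L * (b - c).
  apply/ler_addgt0Pr => e e0; have [del del0 hdel] := cg c cab e e0.
  pose c' := Num.min b (c + del / 2).
  have cc' : c < c' by rewrite lt_min ltcb ltrDl divr_gt0.
  have c'b : c' <= b by rewrite ge_min lexx.
  have ac' : a <= c' by rewrite (le_trans aa') // (le_trans a'c) // ltW.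
  rewrite (le_trans (ler_distD (g c') _ _)) // lerD //; last first.
    rewrite distrC; apply/ltW/hdel; first by rewrite ac'.
    rewrite distrC ger0_norm ?subr_ge0 ?(ltW cc') // ltrBlDl.
    by rewrite gt_min ltrD2l [X in _ || X](_ : _ = true) ?orbT //; lra.
  apply: (@le_trans _ _ (L * (b - c'))); last by rewrite ler_wpM2l // lerB // ltW.
  apply: (IHk (A :\ i)%SET); first by rewrite (cardsD1 i A) iA in leA.
    by rewrite ac'.
  move=> x /andP[c'x xb]; have [|j jA Cjx] := covA x.
    by rewrite xb (le_trans a'c) // (le_trans (ltW cc')).
  exists j => //; rewrite !inE jA andbT; apply/eqP => ji.
  suff : x <= c by rewrite leNgt (lt_le_trans cc').
  apply: ub_le_sup; first by case: hS.
  by split; [rewrite xb (le_trans a'c) // (le_trans (ltW cc')) | rewrite -ji].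
rewrite (le_trans (ler_distD (g c) _ _)) //.
by rewrite -[b - a'](subrKA c) mulrDr lerD.
Qed.

Context (d : nat).

Lemma within_continuous_dist (D : set 'rV[R]_d) (F : 'rV[R]_d -> R) x e :
  {within D, continuous F} -> D x -> 0 < e ->
  exists2 del, 0 < del & forall y, D y -> `|x - y| < del -> `|F x - F y| < e.
Proof.
move=> /subspace_continuousP cF Dx e0.
have /cvgrPdist_lt /(_ e e0) := cF x Dx.
rewrite near_withinE => /nbhs_ballP [del del0 H].
exists del => // y Dy xy; apply: H => //; rewrite -ball_normE //.
Qed.

Lemma norm_delta_row (k : 'I_d) : `|delta_mx 0 k : 'rV[R]_d| = 1.
Proof.
apply/eqP; rewrite eq_le; apply/andP; split.
  rewrite /Num.Def.normr /= mx_normrE; apply: bigmax_le => // i _.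
  by rewrite mxE; case: (_ && _); rewrite ?normr1 ?normr0.
by apply: le_trans (le_coord_norm (delta_mx 0 k : 'rV[R]_d) k); rewrite mxE !eqxx normr1.
Qed.

Lemma lipschitz_along_line (I : finType) (C : I -> set 'rV[R]_d) (D : set 'rV[R]_d)
    (F : 'rV[R]_d -> R) (L : R) (k : 'I_d) (x : 'rV[R]_d) (h : R) :
  0 <= L -> 0 <= h -> {within D, continuous F} ->
  (forall s, 0 <= s <= h -> D (x + s *: delta_mx 0 k)) ->
  (forall y, D y -> exists i, C i y) -> (forall i, lipschitz_with (C i) F L) ->
  `|F (x + h *: delta_mx 0 k) - F x| <= L * h.
Proof.
move=> L0 h0 cF segD cov lip.
have dE s s' : `|(x + s *: delta_mx 0 k) - (x + s' *: delta_mx 0 k)| = `|s - s'|.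
  by rewrite opprD addrACA subrr add0r -scalerBl normrZ norm_delta_row mulr1.
have := @lipschitz_of_finite_cover I
  (fun i => [set s | C i (x + s *: delta_mx 0 k)])
  (fun s => F (x + s *: delta_mx 0 k)) L 0 h h0.
rewrite scale0r addr0 subr0; apply => //.
- move=> s sh e e0; have [del del0 H] := within_continuous_dist cF (segD s sh) e0.
  by exists del => // s' sh' ss'; apply: H; [exact: segD | rewrite dE].
- by move=> s /segD /cov.
- by move=> i s s' Cs Cs'; rewrite -(dE s s'); apply: lip Cs Cs'.
Qed.

End LipschitzPieces.

(** * Integral of a partial derivative over a box *)

Section BoxIntegral.
Context (R : realType) (d : nat).
Notation RT := (measurableTypeR R).
Notation mu := (lebesgue_tuple R d).
Notation rv := (@rv_of_tuple R d).
Implicit Types (a b tau : 'rV[R]_d) (F G : 'rV[R]_d -> R).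

Lemma rv_tuple_shift tau t : rv (tuple_shift (tau 0) t) = rv t + tau.
Proof. by apply/rowP => k; rewrite !mxE tnth_mktuple. Qed.

Lemma Rintegral_translate tau F : measurable_fun setT (F \o rv) ->
  \int[mu]_t F (rv t + tau) = \int[mu]_t F (rv t).
Proof.
move=> mF; rewrite /Rintegral; congr fine.
pose phi := tuple_shift (tau 0).
have mphi : measurable_fun setT phi by exact: measurable_tuple_shift.
have ge0 (g : d.-tuple RT -> \bar R) : measurable_fun setT g ->
    (forall t, 0 <= g t)%E -> (\int[mu]_t (g \o phi) t = \int[mu]_t g t)%E.
  move=> mg g0; have := @ge0_integral_pushforward _ _ _ _ R phi mphi mu setT g measurableT mg.
  rewrite preimage_setT => <- //.
  apply: eq_measure_integral => A mA _; exact: lebesgue_tuple_translate.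
pose f t := (F (rv t))%:E.
have mf : measurable_fun setT f by exact/measurable_EFinP.
transitivity (\int[mu]_t (f \o phi) t)%E.
  by apply: eq_integral => t _; rewrite /f /= rv_tuple_shift.
rewrite -[RHS]/(\int[mu]_t f t)%E (integralE mu setT (f \o phi))
  (integralE mu setT f) funepos_comp funeneg_comp !ge0 //.
  exact: measurable_funeneg.
exact: measurable_funepos.
Qed.

Definition closed_box a b : set 'rV[R]_d :=
  [set x | forall j, a 0 j <= x 0 j <= b 0 j].

Definition halfopen_box a b : set 'rV[R]_d :=
  [set x | forall j, a 0 j <= x 0 j < b 0 j].

Lemma halfopen_boxE a b : rv @^-1` halfopen_box a b =
  [set t | forall j, `[a 0 j, b 0 j[%classic (tnth t j)].
Proof.
by apply/seteqP; split => t /= h j; have := h j; rewrite /= in_itv /= !mxE.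
Qed.

Lemma measurable_halfopen_box a b : measurable (rv @^-1` halfopen_box a b).
Proof.
rewrite halfopen_boxE (_ : mkset _ = \bigcap_(j in [set: 'I_d])
    ((fun t => tnth t j) @^-1` `[a 0 j, b 0 j[%classic)).
  apply: fin_bigcap_measurable => [|k _]; first exact: finite_finset.
  by rewrite -[X in measurable X]setTI; apply: measurable_tnth => //; exact: measurable_itv.
by apply/seteqP; split => t /= h k; [move=> _; exact: h | exact: (h k I)].
Qed.

Lemma lebesgue_halfopen_box_lty a b : (mu (rv @^-1` halfopen_box a b) < +oo)%E.
Proof.
rewrite halfopen_boxE (lebesgue_tuple_box (B := fun j => `[a 0 j, b 0 j[%classic)); last first.
  by move=> j; exact: measurable_itv.
rewrite -ge0_fin_numE; last by apply: prode_ge0 => j _; exact: measure_ge0.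
apply: prode_fin_num => j _; rewrite lebesgue_measure_itv /=.
by case: ifP.
Qed.

Variables (a b : 'rV[R]_d) (k : 'I_d).
Hypothesis ab : forall j, a 0 j < b 0 j.
Notation e := (delta_mx 0 k : 'rV[R]_d).
Let p := b 0 k - a 0 k.
Let p_gt0 : 0 < p. Proof. by rewrite subr_gt0. Qed.
Notation E := (halfopen_box a b).
Notation Ebar := (closed_box a b).

Let coord_shift x s j : (x + s *: e) 0 j = x 0 j + s * (j == k)%:R.
Proof. by rewrite !mxE eqxx. Qed.

Let E_Ebar x : E x -> Ebar x.
Proof. by move=> Ex j; case/andP: (Ex j) => -> /ltW ->. Qed.

Let Ebar_line x s : E x -> a 0 k <= x 0 k + s <= b 0 k -> Ebar (x + s *: e).
Proof.
move=> /E_Ebar Ex xs j; rewrite coord_shift; case: eqVneq => [->|_].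
  by rewrite mulr1.
by rewrite mulr0 addr0.
Qed.

Let E_line x s : E x -> E (x + s *: e) <-> a 0 k <= x 0 k + s < b 0 k.
Proof.
move=> Ex; split => [/(_ k)|xs j]; rewrite coord_shift; first by rewrite eqxx mulr1.
by case: eqVneq => [->|_]; rewrite ?mulr1 // mulr0 addr0.
Qed.

Variables (J : finType) (C : J -> set 'rV[R]_d) (F G : 'rV[R]_d -> R) (L B : R).
Hypothesis L_ge0 : 0 <= L.
Hypothesis F_continuous : {within Ebar, continuous F}.
Hypothesis F_bounded : forall x, Ebar x -> `|F x| <= B.
Hypothesis C_cover : forall x, Ebar x -> exists i, C i x.
Hypothesis C_lipschitz : forall i, lipschitz_with (C i) F L.
Hypothesis F_periodic : forall x, Ebar x -> x 0 k = a 0 k -> F (x + p *: e) = F x.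

(* Fper is the periodic extension of F, over two periods only: this is enough
   for translations by less than one period. *)
Let F0 := F \_ E.
Let Fper x := F0 x + F0 (x - p *: e).

Let measurable_F0 : measurable_fun setT (F0 \o rv).
Proof.
have mE := measurable_halfopen_box a b.
have -> : F0 \o rv = (F \o rv) \_ (rv @^-1` E) by apply/funext => t; rewrite /= !patchE.
apply/(measurable_restrictT _ mE).
apply: within_continuous_measurable_rv => //.
by apply: continuous_subspaceW F_continuous; exact: E_Ebar.
Qed.

Let Fper_in x h : E x -> 0 < h < p -> x 0 k + h < b 0 k ->
  Fper (x + h *: e) = F (x + h *: e).
Proof.
move=> Ex /andP[h0 hp] xhb; have /andP[ax xb] := Ex k.
rewrite /Fper /F0 !patchE mem_set; last first.
  by apply/E_line => //; rewrite xhb andbT (le_trans ax) // lerDl ltW.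
rewrite memNset ?addr0 // -addrA -scalerBl E_line //.
move=> /andP[+ _]; apply/negP; rewrite -ltNge /p; lra.
Qed.

Let Fper_out x h : E x -> 0 < h < p -> b 0 k <= x 0 k + h ->
  Fper (x + h *: e) = F (x + (h - p) *: e).
Proof.
move=> Ex /andP[h0 hp] xhb; have /andP[ax xb] := Ex k.
rewrite /Fper /F0 !patchE memNset; last by rewrite E_line // => /andP[_]; rewrite ltNge xhb.
rewrite -addrA -scalerBl mem_set ?add0r //; apply/E_line => //.
move: xhb hp; rewrite /p => xhb hp; lra.
Qed.

Let Fper_lipschitz x h : E x -> 0 < h < p -> `|Fper (x + h *: e) - F x| <= L * h.
Proof.
move=> Ex hp; have /andP[h0 hltp] := hp; have /andP[ax xb] := Ex k.
have [xhb|xhb] := ltP (x 0 k + h) (b 0 k).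
  rewrite Fper_in //;
    apply: (lipschitz_along_line L_ge0 (ltW h0) F_continuous _ C_cover C_lipschitz).
  by move=> s /andP[s0 sh]; apply: Ebar_line => //; lra.
rewrite Fper_out //.
pose x0 := x + (a 0 k - x 0 k) *: e.
have -> : x + (h - p) *: e = x0 + (h - p - (a 0 k - x 0 k)) *: e.
  by rewrite /x0 -addrA -scalerDl subrKC.
pose x1 := x + (b 0 k - x 0 k) *: e.
have Fx0 : F x0 = F x1.
  rewrite -(F_periodic (x := x0)).
  - by rewrite /x0 /x1 -addrA -scalerDl /p; congr (F (_ + _ *: _)); ring.
  - by apply: Ebar_line => //; rewrite subrKC lexx ltW.
  - by rewrite /x0 coord_shift eqxx mulr1 subrKC.
rewrite (le_trans (ler_distD (F x0) _ _)) // {2}Fx0.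
have s0 : 0 <= h - p - (a 0 k - x 0 k) by move: xhb; rewrite /p; lra.
have -> : L * h = L * (h - p - (a 0 k - x 0 k)) + L * (b 0 k - x 0 k).
  by rewrite -mulrDr /p; congr (_ * _); ring.
apply: lerD.
  apply: (lipschitz_along_line L_ge0 s0 F_continuous _ C_cover C_lipschitz).
  move=> s /andP[s1 s2]; rewrite /x0 -addrA -scalerDl; apply: Ebar_line => //.
  move: s2 hltp; rewrite /p => s2 hltp; lra.
have xb0 : 0 <= b 0 k - x 0 k by rewrite subr_ge0 ltW.
apply: (lipschitz_along_line L_ge0 xb0 F_continuous _ C_cover C_lipschitz).
by move=> s /andP[s1 s2]; apply: Ebar_line => //; lra.
Qed.

Let measurable_shift_F0 tau : measurable_fun setT (fun t => F0 (rv t + tau)).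
Proof.
rewrite (_ : (fun t => _) = (F0 \o rv) \o tuple_shift (tau 0)); last first.
  by apply/funext => t /=; rewrite rv_tuple_shift.
exact: measurableT_comp (measurable_tuple_shift _).
Qed.

Let measurable_Fper h : measurable_fun setT (fun t => Fper (rv t + h *: e)).
Proof.
apply: measurable_funD => /=; first exact: measurable_shift_F0.
rewrite (_ : (fun t => _) = (fun t => F0 (rv t + (h *: e - p *: e)))) //.
by apply/funext => t /=; rewrite addrA.
Qed.

(* Modulo the period p, translation by h permutes the points of the box: exactly
   one of the two candidates for the preimage of x lies in it. *)
Let E_split x h : E x -> 0 < h < p ->
  \1_E (x - h *: e) + \1_E (x + (p - h) *: e) = 1 :> R.
Proof.
move=> Ex /andP[h0 hp]; have /andP[ax xb] := Ex k.
rewrite !indicE -scaleNr; have [xh|xh] := leP (a 0 k) (x 0 k - h).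
  rewrite mem_set; last by apply/E_line => //; rewrite xh /=; lra.
  rewrite memNset ?addr0 // E_line // => /andP[_]; move: xh; rewrite /p => xh; lra.
rewrite memNset; last by rewrite E_line // => /andP[]; rewrite leNgt xh.
rewrite mem_set ?add0r //; apply/E_line => //.
move: hp; rewrite /p => hp; lra.
Qed.

Let bounded_integrable (f : 'rV[R]_d -> R) (K : R) :
  measurable_fun setT (f \o rv) -> (forall x, `|f x| <= K) ->
  mu.-integrable (rv @^-1` E) (EFin \o (f \o rv)).
Proof.
move=> mf bf; apply: measurable_bounded_integrable.
- exact: measurable_halfopen_box.
- exact: lebesgue_halfopen_box_lty.
- exact: measurable_funTS.
- exists K; split; first exact: num_real.
  by move=> y Ky t _; apply: le_trans (bf _) (ltW Ky).
Qed.

Let mem_pre (A : set 'rV[R]_d) t : (t \in rv @^-1` A) = (rv t \in A).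
Proof. by []. Qed.

Let F0_le x : `|F0 x| <= `|B|.
Proof.
rewrite /F0 patchE; case: ifPn => [/set_mem/E_Ebar/F_bounded FB|_].
  exact: le_trans FB (ler_norm _).
by rewrite normr0.
Qed.

Let measurable_shift_indic tau :
  measurable_fun setT (fun t => \1_E (rv t - tau) : R).
Proof.
have -> : (fun t => \1_E (rv t - tau) : R) =
    \1_(rv @^-1` E) \o tuple_shift ((- tau) 0).
  by apply/funext => t /=; rewrite -rv_tuple_shift !indicE.
apply: measurableT_comp; last exact: measurable_tuple_shift.
by apply: measurable_indic; exact: measurable_halfopen_box.
Qed.

Let integral_F0_shift tau :
  \int[mu]_(t in rv @^-1` E) F0 (rv t + tau) =
  \int[mu]_(t in rv @^-1` E) (\1_E (rv t - tau) * F0 (rv t)).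
Proof.
rewrite Rintegral_mkcond [RHS]Rintegral_mkcond.
pose H x := \1_E (x - tau) * F0 x.
transitivity (\int[mu]_t H (rv t + tau)).
  apply: eq_Rintegral => t _; rewrite /H addrK patchE indicE.
  by rewrite mem_pre; case: ifP; rewrite ?mul1r ?mul0r.
rewrite (@Rintegral_translate tau H); last first.
  by apply: measurable_funM; [exact: measurable_shift_indic | exact: measurable_F0].
apply: eq_Rintegral => t _; rewrite /H /F0 !patchE.
by rewrite mem_pre; case: ifP; rewrite ?mulr0.
Qed.

(* Translating each of the two terms of Fper moves the shift to the indicator
   of the box, and the two indicators add up to one by [E_split]. *)
Let integral_Fper h : 0 < h < p ->
  \int[mu]_(t in rv @^-1` E) Fper (rv t + h *: e) =
  \int[mu]_(t in rv @^-1` E) F0 (rv t).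
Proof.
move=> hp; have mE := measurable_halfopen_box a b.
have iF0 tau : mu.-integrable (rv @^-1` E) (EFin \o (fun t => F0 (rv t + tau))).
  exact: (bounded_integrable (f := fun x => F0 (x + tau)) (measurable_shift_F0 tau)).
have iF1 tau : mu.-integrable (rv @^-1` E)
    (EFin \o (fun t => \1_E (rv t - tau) * F0 (rv t))).
  apply: (bounded_integrable (f := fun x => \1_E (x - tau) * F0 x) (K := `|B|)).
    by apply: measurable_funM; [exact: measurable_shift_indic | exact: measurable_F0].
  move=> x; rewrite indicE; case: (_ \in _); rewrite ?mul1r ?mul0r ?normr0 //.
transitivity (\int[mu]_(t in rv @^-1` E) F0 (rv t + h *: e) +
    \int[mu]_(t in rv @^-1` E) F0 (rv t + (h - p) *: e)).
  rewrite -RintegralD //.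
  by apply: eq_Rintegral => t _; rewrite /Fper -addrA -scalerBl.
rewrite !integral_F0_shift -RintegralD //.
apply: eq_Rintegral => t; rewrite mem_pre => /set_mem Et.
have -> : rv t - (h - p) *: e = rv t + (p - h) *: e by rewrite -scaleNr opprB.
by rewrite -mulrDl E_split // mul1r.
Qed.

Variable N : set (d.-tuple RT).
Hypotheses (mN : measurable N) (N_null : mu N = 0%E).
Hypothesis F_derive : forall t, E (rv t) -> ~ N t -> is_derive (rv t) e F (G (rv t)).

(** The difference quotients of Fper have zero integral by [integral_Fper], are
    bounded by L by [Fper_lipschitz], and converge to G off N. *)
Lemma integral_partial_periodic_eq0 : integral_Rd E G = 0.
Proof.
have mE := measurable_halfopen_box a b.
pose D := rv @^-1` E `\` N.
have mD : measurable D by exact: measurableD.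
pose h i : R := p / i.+2%:R.
have h_in i : 0 < h i < p.
  rewrite divr_gt0 //= ltr_pdivrMr ?ltr_pMr ?ltr1n //.
have h_cvg : h i @[i --> \oo] --> 0.
  rewrite -(mulr0 p); apply: cvgM; first exact: cvg_cst.
  have := @cvg_harmonic R; rewrite -cvg_shiftS; exact.
pose g i x := (Fper (x + h i *: e) - F0 x) / h i.
have mg i : measurable_fun setT (g i \o rv).
  apply: measurable_funM; last exact: measurable_cst.
  exact: measurable_funB (measurable_Fper _) measurable_F0.
have g_le i x : E x -> `|g i x| <= L.
  move=> Ex; rewrite /g normrM normfV.
  have /andP[hi0 _] := h_in i; rewrite (gtr0_norm hi0) ler_pdivrMr //.
  by rewrite /F0 patchE mem_set //; exact: Fper_lipschitz.
have off_N f : \int[mu]_(t in D) f t = \int[mu]_(t in rv @^-1` E) f t.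
  apply: (Rintegral_off_null mN N_null) => t Nt; rewrite !patchE /D in_setD.
  by rewrite (memNset Nt) andbT.
have g_int i : \int[mu]_(t in D) g i (rv t) = 0.
  have iF0 : mu.-integrable (rv @^-1` E) (EFin \o (F0 \o rv)).
    exact: bounded_integrable F0_le.
  have iF : mu.-integrable (rv @^-1` E) (EFin \o (fun t => Fper (rv t + h i *: e))).
    apply: (bounded_integrable (f := fun x => Fper (x + h i *: e)) (measurable_Fper _)
      (K := `|B| + `|B|)) => x.
    by rewrite (le_trans (ler_normD _ _)) // lerD.
  rewrite off_N RintegralZr //; last first.
    exact: (integrableB mE iF iF0).
  rewrite RintegralB //.
  by rewrite integral_Fper // subrr mul0r.
have g_cvg t : D t -> g i (rv t) @[i --> \oo] --> G (rv t).
  move=> [Et Nt]; have [dF <-] := F_derive Et Nt.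
  have /cvgr_dnbhsP/(_ h) := dF.
  have h_gt0 i : 0 < h i by case/andP: (h_in i).
  move=> H; apply: cvg_trans (H _); last by split=> // i; rewrite gt_eqF.
  apply: near_eq_cvg; near=> i.
  rewrite /g /F0 patchE mem_set //= Fper_in //; last first.
    rewrite -ltrBrDl; near: i.
    by apply: (cvgr_lt _ h_cvg); rewrite subr_gt0; case/andP: (Et k).
  by rewrite [RHS]mulrC [rv t + _]addrC.
have mgD i : measurable_fun D (fun t => (g i (rv t))%:E).
  by apply/measurable_EFinP; exact: (measurable_funTS (mg i)).
have egcvg t : D t -> (g i (rv t))%:E @[i --> \oo] --> (G (rv t))%:E.
  move=> Dt; apply: cvg_EFin; first by apply: nearW.
  exact: (g_cvg t Dt).
have iL : mu.-integrable D (cst L%:E).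
  apply: (integrableS mE mD) => //; first by move=> t [].
  exact: (bounded_integrable (f := cst L) (measurable_cst _) (K := `|L|)).
have gL : {ae mu, forall t i, D t -> (`|(g i (rv t))%:E| <= cst L%:E t)%E}.
  by apply: aeW => t i [Et _]; rewrite lee_fin g_le.
have [_ _] := dominated_convergence mD mgD (emeasurable_fun_cvg _ _ mgD egcvg)
  (aeW _ egcvg) iL gL.
rewrite (_ : (fun i => _) = cst 0%E); last first.
  apply/funext => i /=; rewrite -[LHS]fineK; last first.
    apply: integrable_fin_num => //; apply: (integrableS mE mD) => [t []//|].
    have gE : measurable_fun (rv @^-1` E) (g i \o rv) by exact: measurable_funTS.
    apply: (measurable_bounded_integrable mE (lebesgue_halfopen_box_lty a b) gE).
    exists L; split; first exact: num_real.
    by move=> y Ly t Et; apply: le_trans (g_le _ _ Et) (ltW Ly).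
  by rewrite [fine _]g_int.
move=> lim0; have G0 := cvg_unique _ lim0 (cvg_cst 0%E).
by rewrite /integral_Rd -off_N /Rintegral G0.
Unshelve. all: by end_near. Qed.

End BoxIntegral.

(** * Barycentric coordinates *)

Section Barycentric.
Context (R : realType) (d : nat).
Implicit Types (V : 'M[R]_(d.+1, d)) (x : 'rV[R]_d).

(** Barycentric coordinates solve a linear system whose matrix is the homogenized
    vertex matrix.  It is square, but its dimensions d.+1 and d + 1 are only
    propositionally equal, hence a pseudo-inverse in [bary]. *)
Definition homogenize m (X : 'M[R]_(m, d)) : 'M[R]_(m, d + 1) :=
  row_mx X (const_mx 1).

Definition bary V x : 'rV[R]_d.+1 := homogenize x *m pinvmx (homogenize V).

Definition bary_coef V i k : R := pinvmx (homogenize V) (lshift 1 k) i.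
Definition bary_const V i : R := pinvmx (homogenize V) (rshift d 0) i.

Lemma baryE V x i : bary V x 0 i = \sum_k bary_coef V i k * x 0 k + bary_const V i.
Proof.
rewrite mxE big_split_ord /= big_ord1; congr (_ + _).
  by apply: eq_bigr => k _; rewrite row_mxEl mulrC.
by rewrite row_mxEr mxE mul1r.
Qed.

(** A coordinate that vanished identically would be a zero column of the inverse
    of an invertible matrix. *)
Lemma bary_nonconstant V i : affinely_independent V ->
  bary_const V i = 0 -> exists k, bary_coef V i k != 0.
Proof.
move=> aV c0; apply: contrapT => nex.
have : (homogenize V *m pinvmx (homogenize V)) i i = 1.
  by rewrite mulmxVp // mxE eqxx.
rewrite mxE big_split_ord /= big_ord1 -/(bary_const V i) c0 mulr0 addr0 big1.
  by move/eqP; rewrite eq_sym oner_eq0.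
move=> k _; rewrite -/(bary_coef V i k).
case: (eqVneq (bary_coef V i k) 0) => [->|n0]; first by rewrite mulr0.
by exfalso; apply: nex; exists k.
Qed.

Lemma simplexP V x : affinely_independent V ->
  simplex V x <-> forall i, 0 <= bary V x 0 i.
Proof.
move=> aV; split=> [[l [l0 l1 _ ->]] i|h].
  suff -> : bary V (l *m V) = l by [].
  rewrite /bary; have -> : homogenize (l *m V) = l *m homogenize V.
    rewrite /homogenize mul_mx_row; congr row_mx.
    apply/matrixP => a b; rewrite !mxE ord1 -[LHS]l1.
    by apply: eq_bigr => j _; rewrite mxE mulr1.
  by rewrite -mulmxA mulmxVp // mulmx1.
have : bary V x *m homogenize V = homogenize x.
  rewrite /bary mulmxKpV // submx_full // /row_full.
  by move: aV; rewrite /affinely_independent /row_free -/(homogenize V) => /eqP ->; rewrite addn1.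
rewrite /homogenize mul_mx_row => /eq_row_mx [xE sE].
exists (bary V x); split=> // [|i]; last by rewrite inE.
have : (bary V x *m (const_mx 1 : 'cV_d.+1)) 0 0 = 1 by rewrite sE mxE.
rewrite mxE => <-; by apply: eq_bigr => j _; rewrite [X in _ * X]mxE mulr1.
Qed.

(** The topological interior, described by strict inequalities so that what is
    left of the simplex visibly lies in finitely many hyperplanes. *)
Definition simplex_inside V : set 'rV[R]_d := [set x | forall i, 0 < bary V x 0 i].

Lemma open_simplex_inside V : open (simplex_inside V).
Proof.
rewrite openE => x Vx.
apply: (@filter_forall 'rV[R]_d _ (fun i y => 0 < bary V y 0 i) (nbhs x)) => i.
have bc : {for x, continuous (fun y => bary V y 0 i)}.
  rewrite (_ : (fun y => _) =
      fun y : 'rV[R]_d => \sum_k bary_coef V i k * y 0 k + bary_const V i); last first.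
    by apply/funext => y; rewrite baryE.
  apply: (@continuousD _ _ _ (fun y : 'rV[R]_d => \sum_k bary_coef V i k * y 0 k)
    (cst (bary_const V i))); last exact: cst_continuous.
  apply: continuous_big => [|k _ y]; first exact: add_continuous.
  apply: (@continuousM _ _ (cst (bary_coef V i k)) (fun y : 'rV[R]_d => y 0 k)).
    exact: cst_continuous.
  exact: coord_continuous.
exact: (cvgr_gt _ bc _ (Vx i)).
Qed.

Lemma simplex_inside_sub V : affinely_independent V ->
  simplex_inside V `<=` simplex V.
Proof. by move=> aV x h; apply/simplexP => // i; exact: ltW. Qed.

Lemma simplex_inside_interior V : affinely_independent V ->
  simplex_inside V `<=` interior (simplex V).
Proof.
move=> aV; rewrite -open_subsetE; first exact: simplex_inside_sub.
exact: open_simplex_inside.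
Qed.

Lemma simplex_boundary V x : affinely_independent V -> simplex V x ->
  simplex_inside V x \/ exists i, bary V x 0 i = 0.
Proof.
move=> aV /(simplexP _ aV) h; case: (pselect (exists i, bary V x 0 i = 0)); first by right.
move=> nex; left => i; rewrite lt_neqAle h andbT eq_sym.
by apply/eqP => bi; apply: nex; exists i.
Qed.

End Barycentric.

(** * Integration of piecewise polynomial functions over a mesh *)

Section MeshIntegral.
Context (R : realType) (d n : nat).
Notation RT := (measurableTypeR R).
Notation mu := (lebesgue_tuple R d).
Notation rv := (@rv_of_tuple R d).
Variables (Omega Lambda : set 'rV[R]_d) (T : 'I_n -> 'M[R]_(d.+1, d)).
Hypotheses (Omega_open : open Omega) (Omega_bounded : bounded_set Omega).
Hypothesis T_mesh : conforming_mesh Omega Lambda T.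

Definition mesh_inside_set : set 'rV[R]_d := \bigcup_K simplex_inside (T K).

(** The whole hyperplanes spanned by the facets: this null set contains the mesh
    skeleton and is obviously measurable. *)
Definition skeleton : set (d.-tuple RT) :=
  \bigcup_(Ki : 'I_n * 'I_d.+1)
    affine_zeros (bary_coef (T Ki.1) Ki.2) (bary_const (T Ki.1) Ki.2).

Lemma measurable_skeleton : measurable skeleton.
Proof.
apply: countable_bigcupT_measurable => [|Ki]; first exact: countableP.
exact: measurable_affine_zeros.
Qed.

Lemma skeleton_null : mu skeleton = 0%E.
Proof.
pose Z (Ki : 'I_n * 'I_d.+1) : set (d.-tuple RT) :=
  affine_zeros (bary_coef (T Ki.1) Ki.2) (bary_const (T Ki.1) Ki.2).
have mZ Ki : measurable (Z Ki) by exact: measurable_affine_zeros.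
have H (s : seq ('I_n * 'I_d.+1)) : mu (\big[setU/set0]_(Ki <- s) Z Ki) = 0%E.
  elim: s => [|Ki s IHs]; first by rewrite big_nil measure0.
  rewrite big_cons null_set_setU //.
    by apply: bigsetU_measurable => *; exact: mZ.
  by apply: affine_zeros_null; apply: bary_nonconstant; exact: mesh_nondegenerate T_mesh _.
rewrite -(H (enum {: 'I_n * 'I_d.+1})) -bigcup_seq; congr (mu _).
by apply: eq_bigcupl; split=> // x _; rewrite /= mem_enum.
Qed.

Lemma mesh_inside_Omega : mesh_inside_set `<=` Omega.
Proof.
move=> x [K _ xK]; apply: (mesh_inside T_mesh (K := K)).
by apply: simplex_inside_interior => //; exact: mesh_nondegenerate T_mesh _.
Qed.

Lemma closure_off_skeleton t : closure Omega (rv t) -> ~ skeleton t ->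
  mesh_inside_set (rv t).
Proof.
rewrite (mesh_cover T_mesh) => -[K _ tK] nsk; exists K => //.
have [//|[i bi]] := simplex_boundary (mesh_nondegenerate T_mesh K) tK.
exfalso; apply: nsk; exists (K, i) => //=; rewrite /affine_zeros /= -[RHS]bi baryE.
by congr +%R; apply: eq_bigr => k _; rewrite !mxE.
Qed.

Lemma open_mesh_inside : open mesh_inside_set.
Proof. by apply: bigcup_open => K _; exact: open_simplex_inside. Qed.

Lemma measurable_mesh_inside : measurable (rv @^-1` mesh_inside_set).
Proof. by apply: measurable_open_rv; exact: open_mesh_inside. Qed.

Lemma integral_mesh (f : 'rV[R]_d -> R) :
  integral_Rd Omega f = \int[mu]_(t in rv @^-1` mesh_inside_set) f (rv t).
Proof.
apply: (Rintegral_off_null measurable_skeleton skeleton_null) => t nsk.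
rewrite !patchE; case: ifPn => [/set_mem Ot|nOt].
  rewrite mem_set //; apply: closure_off_skeleton => //; exact: subset_closure.
rewrite memNset // => /mesh_inside_Omega Ot.
by move/negP: nOt; apply; rewrite inE.
Qed.

Lemma closure_Omega_bounded : bounded_set (closure Omega).
Proof.
have [B0 [B0r bO]] := Omega_bounded.
exists B0; split=> // B ltB.
have cB : closed [set x : 'rV[R]_d | `|x| <= B].
  rewrite (_ : mkset _ = (fun x : 'rV[R]_d => `|x|) @^-1` [set y | y <= B]) //.
  apply: closed_comp; last exact: closed_le.
  by move=> x _; exact: norm_continuous.
have : closure Omega `<=` [set x | `|x| <= B].
  by rewrite [X in _ `<=` X](closure_id _).1 //; apply: closureS => x /bO; apply.
exact.
Qed.

Lemma simplex_bounded K : bounded_set (simplex (T K)).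
Proof.
have [B0 [B0r bO]] := closure_Omega_bounded.
exists B0; split=> // B ltB x xK; apply: (bO B ltB).
by rewrite (mesh_cover T_mesh); exists K.
Qed.

Lemma Omega_in_box : exists2 B, 0 < B & forall x, closure Omega x -> forall k, - B < x 0 k < B.
Proof.
have [B0 [B0r bO]] := closure_Omega_bounded.
exists (`|B0| + 2); first by rewrite ltr_wpDl.
move=> x /(bO (`|B0| + 1)) xB k; rewrite -ltr_norml.
apply: le_lt_trans (le_coord_norm x k) _; apply: le_lt_trans (xB _) _.
  by rewrite (le_lt_trans (ler_norm _)) // ltrDl.
by rewrite ltrD2l ltr1n.
Qed.

Lemma mesh_inside_lty : (mu (rv @^-1` mesh_inside_set) < +oo)%E.
Proof.
have [B B0 bO] := Omega_in_box.
apply: le_lt_trans (lebesgue_halfopen_box_lty (const_mx (- B)) (const_mx B)).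
apply: le_measure; rewrite ?inE; [exact: measurable_mesh_inside|exact: measurable_halfopen_box|].
move=> t /mesh_inside_Omega/subset_closure/bO xB k.
by rewrite !(mxE const_mx_key) ; have /andP[/ltW -> ->] := xB k.
Qed.

Definition piecewise_poly (f : 'rV[R]_d -> R) : Prop :=
  forall K, exists p, forall x, simplex_inside (T K) x -> f x = polyfun p x.

Lemma piecewise_poly_integrable f : piecewise_poly f ->
  mu.-integrable (rv @^-1` mesh_inside_set) (EFin \o (f \o rv)).
Proof.
move=> /choice [p fp]; apply: measurable_bounded_integrable.
- exact: measurable_mesh_inside.
- exact: mesh_inside_lty.
- move=> _ Y mY; rewrite (_ : _ `&` _ = \bigcup_K
      ((rv @^-1` simplex_inside (T K)) `&` ((polyfun (p K) \o rv) @^-1` Y))); last first.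
    apply/seteqP; split => t.
      by move=> [[K _ tK] Yt]; exists K => //; split => //=; rewrite -(fp K).
    by move=> [K _ [tK Yt]]; split; [exists K | rewrite /= (fp K)].
  apply: fin_bigcup_measurable => [|K _]; first exact: finite_finset.
  have mK : measurable (rv @^-1` simplex_inside (T K)).
    by apply: measurable_open_rv; exact: open_simplex_inside.
  exact: (measurable_funTS (@measurable_polyfun R d (p K)) mK mY).
- have bK K : exists C, 0 <= C /\ forall x, simplex_inside (T K) x -> `|f x| <= C.
    have [C bC _] := bounded_lipschitz_polyfun (p K) (simplex_bounded K).
    exists `|C|; split=> // x xK; rewrite (fp _ _ xK).
    rewrite (le_trans (bC _ _)) ?ler_norm //.
    by apply: simplex_inside_sub => //; exact: mesh_nondegenerate T_mesh _.
  have [C hC] := choice bK.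
  exists (\sum_K C K); split; first exact: num_real.
  move=> y Cy t [K _ tK]; apply: le_trans (ltW Cy).
  apply: le_trans ((hC K).2 _ tK) _.
  by rewrite (bigD1 K) //= lerDl sumr_ge0 // => L _; exact: (hC L).1.
Qed.

Lemma piecewise_polyC c : piecewise_poly (fun=> c).
Proof. by move=> K; exists (mpoly.mpolyC d c) => x _; rewrite polyfunC. Qed.

Lemma piecewise_polyD f g : piecewise_poly f -> piecewise_poly g ->
  piecewise_poly (fun x => f x + g x).
Proof.
move=> pf pg K; have [p fp] := pf K; have [q gq] := pg K.
by exists (p + q) => x xK; rewrite polyfunD fp ?gq.
Qed.

Lemma piecewise_polyM f g : piecewise_poly f -> piecewise_poly g ->
  piecewise_poly (fun x => f x * g x).
Proof.
move=> pf pg K; have [p fp] := pf K; have [q gq] := pg K.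
by exists (p * q) => x xK; rewrite polyfunM fp ?gq.
Qed.

Lemma piecewise_poly_sum (I : Type) (s : seq I) (P : pred I) (f : I -> 'rV[R]_d -> R) :
  (forall i, piecewise_poly (f i)) -> piecewise_poly (fun x => \sum_(i <- s | P i) f i x).
Proof.
move=> pf; elim: s => [|i s IHs].
  by under eq_fun do rewrite big_nil; exact: piecewise_polyC.
under eq_fun do rewrite big_cons; case: (P i) => //.
exact: piecewise_polyD.
Qed.

Lemma integral_RdD f g : piecewise_poly f -> piecewise_poly g ->
  integral_Rd Omega (fun x => f x + g x) = integral_Rd Omega f + integral_Rd Omega g.
Proof.
move=> pf pg; rewrite !integral_mesh RintegralD //; first exact: measurable_mesh_inside.
  exact: piecewise_poly_integrable.
exact: piecewise_poly_integrable.
Qed.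

Lemma integral_RdZ c f : piecewise_poly f ->
  integral_Rd Omega (fun x => c * f x) = c * integral_Rd Omega f.
Proof.
move=> pf; rewrite !integral_mesh RintegralZl //; first exact: measurable_mesh_inside.
exact: piecewise_poly_integrable.
Qed.

Lemma integral_Rd_sum (I : Type) (s : seq I) (P : pred I) (f : I -> 'rV[R]_d -> R) :
  (forall i, piecewise_poly (f i)) ->
  integral_Rd Omega (fun x => \sum_(i <- s | P i) f i x) =
  \sum_(i <- s | P i) integral_Rd Omega (f i).
Proof.
move=> pf; elim: s => [|i s IHs].
  under eq_fun do rewrite big_nil.
  have -> : (fun=> 0 : R) = (fun x : 'rV[R]_d => 0 * 0) by apply/funext => x; rewrite mul0r.
  by rewrite integral_RdZ ?mul0r ?big_nil //; exact: piecewise_polyC.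
rewrite big_cons; under eq_fun do rewrite big_cons.
case: ifP => // Pi; rewrite integral_RdD ?IHs //; exact: piecewise_poly_sum.
Qed.

Lemma integral_Rd_ge0 f : (forall x, 0 <= f x) -> 0 <= integral_Rd Omega f.
Proof. by move=> f0; apply: Rintegral_ge0 => t _. Qed.

Lemma eq_integral_Rd f g : (forall x, mesh_inside_set x -> f x = g x) ->
  integral_Rd Omega f = integral_Rd Omega g.
Proof.
move=> fg; rewrite !integral_mesh; apply: eq_Rintegral => t /set_mem; exact: fg.
Qed.

End MeshIntegral.

(** * Integral of a partial derivative over a mesh *)

Section PartialDerivative.
Context (R : realType) (d : nat).

Lemma is_derive_poly_near (U : set 'rV[R]_d) f p k x : open U -> U x ->
  (forall y, U y -> f y = polyfun p y) ->
  is_derive x (delta_mx 0 k) f (polyfun (mpoly.mderiv k p) x).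
Proof.
move=> oU Ux fp; apply: (@near_eq_is_derive _ _ _ (polyfun p)); last first.
  exact: is_derive_polyfun.
near=> y; apply/esym/fp; near: y; exact: open_nbhs_nbhs.
Unshelve. all: by end_near. Qed.

Lemma partial_poly (U : set 'rV[R]_d) f p k x : open U -> U x ->
  (forall y, U y -> f y = polyfun p y) ->
  partial k f x = polyfun (mpoly.mderiv k p) x.
Proof. by move=> oU Ux /(is_derive_poly_near k oU Ux) [_ dE]; exact: dE. Qed.

End PartialDerivative.

Section IntegrationByParts.
Context (R : realType) (d n : nat).
Notation mu := (lebesgue_tuple R d).
Notation rv := (@rv_of_tuple R d).
Variables (Omega Lambda : set 'rV[R]_d) (T : 'I_n -> 'M[R]_(d.+1, d)).
Hypotheses (Omega_open : open Omega) (Omega_bounded : bounded_set Omega).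
Hypothesis T_mesh : conforming_mesh Omega Lambda T.

Definition poly_on_simplices (f : 'rV[R]_d -> R) : Prop :=
  forall K, exists p, forall x, simplex (T K) x -> f x = polyfun p x.

(** Both boundary conditions reduce to this lemma: F extends f by zero outside the
    closed domain, and the pieces on which F is Lipschitz are the simplices
    together with the zero set of F. *)
Lemma integral_partial_box_eq0 (a b : 'rV[R]_d) (k : 'I_d) f :
  (forall j, a 0 j < b 0 j) -> Omega `<=` halfopen_box a b ->
  poly_on_simplices f ->
  {within closed_box a b, continuous (f \_ (closure Omega))} ->
  (forall x, closed_box a b x -> x 0 k = a 0 k ->
    (f \_ (closure Omega)) (x + (b 0 k - a 0 k) *: delta_mx 0 k) =
    (f \_ (closure Omega)) x) ->
  integral_Rd Omega (partial k f) = 0.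
Proof.
move=> ab Obox /choice[p fp] cF perF; pose F := f \_ (closure Omega).
have FK K x : simplex (T K) x -> F x = polyfun (p K) x.
  move=> xK; rewrite /F patchE mem_set ?(fp K) //.
  by rewrite (mesh_cover T_mesh); exists K.
have bK K := bounded_lipschitz_polyfun (p K) (simplex_bounded Omega_bounded T_mesh K).
have {}bK K : exists C, 0 <= C /\
    ((forall x, simplex (T K) x -> `|F x| <= C) /\ lipschitz_with (simplex (T K)) F C).
  have [C bC lC] := bK K; exists `|C|; split=> //; split.
    by move=> x xK; rewrite (FK K) // (le_trans (bC _ xK)) // ler_norm.
  move=> x y xK yK; rewrite !(FK K) // (le_trans (lC _ _ xK yK)) //.
  by rewrite ler_wpM2r // ler_norm.
have [M hM] := choice bK.
pose L := \sum_K M K.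
have ML K : M K <= L.
  by rewrite /L (bigD1 K) //= lerDl sumr_ge0 // => j _; exact: (hM j).1.
have L0 : 0 <= L by apply: sumr_ge0 => j _; exact: (hM j).1.
pose C (o : option 'I_n) : set 'rV[R]_d :=
  if o is Some K then simplex (T K) else [set x | F x = 0].
have Ccov x : exists o, C o x.
  case: (pselect (closure Omega x)) => [|nOx].
    by rewrite (mesh_cover T_mesh) => -[K _ xK]; exists (Some K).
  by exists None; rewrite /= /F patchE memNset.
have Clip o : lipschitz_with (C o) F L.
  case: o => [K|] x y /= xC yC; last by rewrite xC yC subrr normr0 mulr_ge0.
  by apply: le_trans ((hM K).2.2 _ _ xC yC) _; rewrite ler_wpM2r.
have FL x : `|F x| <= L.
  have [[K|] /= xC] := Ccov x; last by rewrite xC normr0.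
  exact: le_trans ((hM K).2.1 _ xC) (ML K).
pose G := (partial k f) \_ (closure Omega).
have FG t : halfopen_box a b (rv t) -> ~ skeleton T t ->
    is_derive (rv t) (delta_mx 0 k) F (G (rv t)).
  move=> tE nsk; rewrite /G patchE; case: ifPn => [/set_mem Ot|nOt].
    have [K _ tK] := closure_off_skeleton T_mesh Ot nsk.
    have sub := simplex_inside_sub (mesh_nondegenerate T_mesh K).
    rewrite (partial_poly k (@open_simplex_inside _ _ _) tK (p := p K)); last first.
      by move=> y /sub; exact: fp.
    by apply: is_derive_poly_near tK _ => [|y /sub]; [exact: open_simplex_inside|exact: FK].
  apply: (is_derive_eq (f' := polyfun (mpoly.mderiv k (mpoly.mpolyC d 0)) (rv t))); last first.
    by rewrite mpoly.mderivC -mpoly.mpolyC0 polyfunC.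
  apply: (@is_derive_poly_near _ _ (~` closure Omega)).
  - by apply: closed_openC; exact: closed_closure.
  - by move: nOt; rewrite notin_setE.
  - by move=> y nOy; rewrite polyfunC /F patchE memNset.
rewrite -[RHS](integral_partial_periodic_eq0 (G := G) ab L0 cF (fun x _ => FL x) (fun x _ => Ccov x)
  Clip perF (@measurable_skeleton _ _ _ T) (skeleton_null T_mesh) FG).
apply: (Rintegral_off_null (@measurable_skeleton _ _ _ T) (skeleton_null T_mesh)) => t nsk.
rewrite !patchE /G !patchE.
case: ifPn => [/set_mem Ot|nOt].
  by rewrite mem_set ?mem_set //; [exact: subset_closure|exact: Obox].
case: ifPn => // /set_mem tE; case: ifPn => // /set_mem Ot.
have /(mesh_inside_Omega T_mesh) := closure_off_skeleton T_mesh Ot nsk.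
by move: nOt; rewrite notin_setE.
Qed.

(** A point of the closed box is approached from inside along the segment to the
    centre. *)
Lemma closed_box_sub_closure (a b : 'rV[R]_d) : (forall j, a 0 j < b 0 j) ->
  closed_box a b `<=` closure (open_box a b).
Proof.
move=> ab x xab B /nbhs_ballP [r r0 rB].
pose c : 'rV[R]_d := \row_j ((a 0 j + b 0 j) / 2).
pose N := `|x - c|; have N0 : 0 <= N by exact: normr_ge0.
pose s := r / (r + N + 1).
have den0 : 0 < r + N + 1 by rewrite ltr_wpDl // addr_ge0 // ltW.
have s0 : 0 < s by rewrite divr_gt0.
have s1 : s < 1 by rewrite ltr_pdivrMr // mul1r -addrA ltrDl ltr_wpDl.
exists (x - s *: (x - c)); split.
  move=> j; rewrite !mxE; have /andP[ax xb] := xab j; have abj := ab j.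
  have sa : 0 <= (1 - s) * (x 0 j - a 0 j) by rewrite mulr_ge0 ?subr_ge0 // ltW.
  have sb : 0 <= (1 - s) * (b 0 j - x 0 j) by rewrite mulr_ge0 ?subr_ge0 // ltW.
  have sab : 0 < s * (b 0 j - a 0 j) by rewrite mulr_gt0 ?subr_gt0.
  nra.
apply: rB; rewrite -ball_normE /= opprB addrC subrK normrZ gtr0_norm //.
rewrite /s mulrAC -mulrA; rewrite gtr_pMr // ltr_pdivrMr // mul1r.
by rewrite addrAC ltrDr addr_gt0.
Qed.

Lemma open_box_sub_halfopen (a b : 'rV[R]_d) : open_box a b `<=` halfopen_box a b.
Proof. by move=> x xab j; have /andP[/ltW -> ->] := xab j. Qed.

(** The extension by zero is continuous, as the two closed sets on which it is
    defined overlap in the boundary, where f vanishes. *)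
Lemma integral_partial_vanishing k f : {within closure Omega, continuous f} ->
  poly_on_simplices f -> (forall x, boundary Omega x -> f x = 0) ->
  integral_Rd Omega (partial k f) = 0.
Proof.
move=> cf pf f0; have [B B0 OB] := Omega_in_box Omega_bounded.
pose F := f \_ (closure Omega).
have F0 x : ~ Omega x -> F x = 0.
  move=> nOx; rewrite /F patchE; case: ifPn => // /set_mem clx; apply: f0.
  by split=> // /interior_subset.
have cF : continuous F.
  apply/continuous_subspace_setT.
  have -> : [set: 'rV[R]_d] = closure Omega `|` ~` Omega.
    apply/seteqP; split => // x _; case: (pselect (Omega x)) => [Ox|]; last by right.
    by left; exact: subset_closure.
  apply: withinU_continuous.
  - exact: closed_closure.
  - exact: open_closedC.
  - apply: subspace_eq_continuous cf => x clx.
    by rewrite /from_subspace /F patchE clx.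
  - apply: (@subspace_eq_continuous _ _ _ (fun=> 0)); last exact: cst_continuous.
    by move=> x /set_mem nOx; rewrite /from_subspace F0.
apply: (@integral_partial_box_eq0 (const_mx (- B)) (const_mx B)) => //.
- by move=> j; rewrite !mxE gtrN.
- move=> x /subset_closure/OB xB j; have /andP[/ltW ? ?] := xB j.
  by rewrite mxE [const_mx B 0 j]mxE; apply/andP.
- exact: continuous_subspaceT.
- move=> x xB xk; rewrite -/F !F0 //.
    by move=> /subset_closure/OB/(_ k); rewrite xk mxE ltxx.
  move=> /subset_closure/OB/(_ k); rewrite !mxE eqxx xk mxE !eqxx mulr1.
  by rewrite opprK addrA addNr add0r ltxx andbF.
Qed.

Lemma integral_partial_periodic (a b : 'rV[R]_d) k f :
  (forall j, a 0 j < b 0 j) -> Omega = open_box a b ->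
  {within closure Omega, continuous f} -> poly_on_simplices f ->
  (forall x, closure Omega x ->
     closure Omega (x + (b 0 k - a 0 k) *: delta_mx 0 k) ->
     f (x + (b 0 k - a 0 k) *: delta_mx 0 k) = f x) ->
  integral_Rd Omega (partial k f) = 0.
Proof.
move=> ab OE cf pf perf.
have cbO x : closed_box a b x -> closure Omega x.
  by rewrite OE; exact: closed_box_sub_closure.
apply: (integral_partial_box_eq0 ab) => //.
- by rewrite OE; exact: open_box_sub_halfopen.
- apply: continuous_subspaceW (cbO) _.
  apply: subspace_eq_continuous cf => x clx.
  by rewrite /from_subspace patchE clx.
- move=> x xab xk.
  have xab' : closed_box a b (x + (b 0 k - a 0 k) *: delta_mx 0 k).
    move=> j; rewrite !mxE eqxx; case: eqVneq => [->|_].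
      by rewrite mulr1 xk subrKC lexx ltW.
    by rewrite mulr0 addr0.
  by rewrite !patchE !mem_set ?perf //; exact: cbO.
Qed.

End IntegrationByParts.

(** * The inner product on piecewise polynomial fields *)

Section Fields.
Context (R : realType) (d m n : nat).
Variables (Omega Lambda : set 'rV[R]_d) (T : 'I_n -> 'M[R]_(d.+1, d)).
Hypotheses (Omega_open : open Omega) (Omega_bounded : bounded_set Omega).
Hypothesis T_mesh : conforming_mesh Omega Lambda T.
Implicit Types u v w : 'rV[R]_d -> 'rV[R]_m.

Definition piecewise_poly_field u : Prop :=
  forall i, piecewise_poly T (fun x => u x 0 i).

Lemma dg_piecewise_poly N u : dg_space T N u -> piecewise_poly_field u.
Proof.
move=> ud i K; have [p _ up] := ud K i.
exists p => x xK; apply: up; apply: simplex_inside_interior => //.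
exact: mesh_nondegenerate T_mesh _.
Qed.

Lemma cg_poly_on_simplices N w : cg_space T Omega Lambda N w ->
  forall i, poly_on_simplices T (fun x => w x 0 i).
Proof. by move=> [_ wp _] i K; have [p _ hp] := wp K i; exists p. Qed.

Lemma poly_on_simplices_piecewise f : poly_on_simplices T f -> piecewise_poly T f.
Proof.
move=> pf K; have [p fp] := pf K; exists p => x xK; apply: fp.
by apply: simplex_inside_sub => //; exact: mesh_nondegenerate T_mesh _.
Qed.

Lemma cg_piecewise_poly N w : cg_space T Omega Lambda N w -> piecewise_poly_field w.
Proof. by move=> /cg_poly_on_simplices wp i; exact: poly_on_simplices_piecewise. Qed.

Lemma piecewise_poly_partial k f : piecewise_poly T f -> piecewise_poly T (partial k f).
Proof.
move=> pf K; have [p fp] := pf K; exists (mpoly.mderiv k p) => x xK.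
by apply: partial_poly xK fp; exact: open_simplex_inside.
Qed.

Lemma piecewise_polyD_field u v : piecewise_poly_field u -> piecewise_poly_field v ->
  piecewise_poly_field (fun x => u x + v x).
Proof.
move=> pu pv i; rewrite (_ : (fun x => _) = fun x => u x 0 i + v x 0 i).
  exact: piecewise_polyD.
by apply/funext => x; rewrite mxE.
Qed.

Lemma piecewise_polyZ_field c u : piecewise_poly_field u ->
  piecewise_poly_field (fun x => c *: u x).
Proof.
move=> pu i; rewrite (_ : (fun x => _) = fun x => c * u x 0 i).
  by apply: piecewise_polyM => //; exact: piecewise_polyC.
by apply/funext => x; rewrite mxE.
Qed.

Lemma piecewise_polyB_field u v : piecewise_poly_field u -> piecewise_poly_field v ->
  piecewise_poly_field (fun x => u x - v x).
Proof.
move=> pu pv; have -> : (fun x => u x - v x) = (fun x => u x + (-1) *: v x).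
  by apply/funext => x; rewrite scaleN1r.
by apply: piecewise_polyD_field => //; exact: piecewise_polyZ_field.
Qed.

Lemma piecewise_poly_dot u v : piecewise_poly_field u -> piecewise_poly_field v ->
  piecewise_poly T (fun x => \sum_i u x 0 i * v x 0 i).
Proof. by move=> pu pv; apply: piecewise_poly_sum => i; exact: piecewise_polyM. Qed.

Notation inner := (L2_inner Omega).

Lemma L2_innerC u v : inner u v = inner v u.
Proof.
by congr integral_Rd; apply/funext => x; apply: eq_bigr => i _; rewrite mulrC.
Qed.

Lemma L2_innerDl u v w : piecewise_poly_field u -> piecewise_poly_field v ->
  piecewise_poly_field w ->
  inner (fun x => u x + v x) w = inner u w + inner v w.
Proof.
move=> pu pv pw; rewrite /L2_inner -(integral_RdD Omega_bounded T_mesh);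
  [|exact: piecewise_poly_dot..].
congr integral_Rd; apply/funext => x; rewrite -big_split.
by apply: eq_bigr => i _; rewrite mxE mulrDl.
Qed.

Lemma L2_innerZl c u v : piecewise_poly_field u -> piecewise_poly_field v ->
  inner (fun x => c *: u x) v = c * inner u v.
Proof.
move=> pu pv; rewrite /L2_inner -(integral_RdZ Omega_bounded T_mesh);
  last exact: piecewise_poly_dot.
congr integral_Rd; apply/funext => x; rewrite big_distrr.
by apply: eq_bigr => i _; rewrite mxE -mulrA.
Qed.

Lemma L2_innerBl u v w : piecewise_poly_field u -> piecewise_poly_field v ->
  piecewise_poly_field w ->
  inner (fun x => u x - v x) w = inner u w - inner v w.
Proof.
move=> pu pv pw.
have -> : (fun x => u x - v x) = (fun x => u x + (-1) *: v x).
  by apply/funext => x; rewrite scaleN1r.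
rewrite L2_innerDl //; last exact: piecewise_polyZ_field.
by rewrite L2_innerZl // mulN1r.
Qed.

Lemma L2_inner_sqrB u v : piecewise_poly_field u -> piecewise_poly_field v ->
  inner (fun x => u x - v x) (fun x => u x - v x) =
  inner u u - inner u v *+ 2 + inner v v.
Proof.
move=> pu pv; have puv : piecewise_poly_field (fun x => u x - v x).
  exact: piecewise_polyB_field.
rewrite L2_innerBl // (L2_innerC u) (L2_innerC v) !L2_innerBl // (L2_innerC v u).
ring.
Qed.

Lemma L2_inner_ge0 u : 0 <= inner u u.
Proof.
by apply: integral_Rd_ge0 => x; apply: sumr_ge0 => i _; rewrite -expr2 sqr_ge0.
Qed.

Lemma eq_L2_inner u u' v : (forall x, mesh_inside_set T x -> u x = u' x) ->
  inner u v = inner u' v.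
Proof.
move=> uu'; apply: (eq_integral_Rd T_mesh) => x xM.
by apply: eq_bigr => i _; rewrite uu'.
Qed.

Lemma L2_norm_sqr u : L2_norm Omega u ^+ 2 = inner u u.
Proof. by rewrite sqr_sqrtr // L2_inner_ge0. Qed.

(** The degenerate case of Cauchy-Schwarz: c (u, v) + (v, v) / 2 would be negative
    for some c if (u, v) were nonzero. *)
Lemma L2_inner_null u v : piecewise_poly_field u -> piecewise_poly_field v ->
  inner u u = 0 -> inner u v = 0.
Proof.
move=> pu pv u0.
pose q c := inner (fun x => c *: u x + v x) (fun x => c *: u x + v x).
have qE c : q c = c *+ 2 * inner u v + inner v v.
  have pcu := piecewise_polyZ_field c pu.
  have pcuv := piecewise_polyD_field pcu pv.
  rewrite /q L2_innerDl // ![inner _ (fun x => _ + _)]L2_innerC !L2_innerDl //.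
  rewrite !L2_innerZl // ![inner _ (fun x => _ *: _)]L2_innerC !L2_innerZl //.
  rewrite u0; ring.
have q0 c : 0 <= c *+ 2 * inner u v + inner v v by rewrite -qE; exact: L2_inner_ge0.
apply/eqP; apply: contraT => uv0.
have := q0 (- (inner v v + 1) / inner u v / 2).
have -> : (- (inner v v + 1) / inner u v / 2) *+ 2 * inner u v = - (inner v v + 1).
  by field.
by rewrite opprD addrAC addNr add0r oppr_ge0 ler10.
Qed.

Variables (A : 'I_m -> 'I_m -> 'I_d -> R).

Lemma dg_A_grad N w : cg_space T Omega Lambda N.+1 w -> dg_space T N (A_grad A w).
Proof.
move=> [_ wp _] K i.
have H j : exists p, (mpoly.msize p <= N.+2)%N /\
    forall x, simplex (T K) x -> w x 0 j = polyfun p x.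
  by have [p sp hp] := wp K j; exists p.
have [p hp] := choice H.
exists (\sum_j \sum_k mpoly.mpolyC d (A i j k) * mpoly.mderiv k (p j)).
  do 2 apply: msize_sum_le => ? _; rewrite mpoly.mul_mpolyC.
  apply: leq_trans (mpoly.msizeZ_le _ _) _; apply: leq_trans (msize_mderiv_le _ _) _.
  by rewrite -subn1 leq_subLR; exact: (hp _).1.
move=> x xK; rewrite mxE.
transitivity (\sum_j \sum_k A i j k * polyfun (mpoly.mderiv k (p j)) x).
  apply: eq_bigr => j _; apply: eq_bigr => k _; congr (_ * _).
  apply: (partial_poly k (@open_interior _ (simplex (T K))) xK) => y /interior_subset.
  exact: (hp j).2.
rewrite -[RHS]/(polyfun _ x) polyfun_sum; apply: eq_bigr => j _.
rewrite polyfun_sum; apply: eq_bigr => k _.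
by rewrite polyfunM polyfunC.
Qed.

Hypothesis A_sym : forall i j k, A i j k = A j i k.

(** Writing S_ijk for the integral of w_i d_k w_j, the sum S_ijk + S_jik is the
    integral of d_k (w_i w_j), which is zero.  So S is antisymmetric in (i, j) and
    its contraction with the symmetric A vanishes. *)
Lemma A_grad_inner_eq0 N w : cg_space T Omega Lambda N w ->
  periodic_box Omega Lambda \/ (forall x, boundary Omega x -> w x = 0) ->
  inner (A_grad A w) w = 0.
Proof.
move=> wcg bc; have [cw _ perw] := wcg.
have pw := cg_piecewise_poly wcg.
pose W i x := w x 0 i.
pose S i j k := integral_Rd Omega (fun x => W i x * partial k (W j) x).
have pS i j k : piecewise_poly T (fun x => W i x * partial k (W j) x).
  by apply: piecewise_polyM; [exact: pw | exact/piecewise_poly_partial/pw].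
have pAS i j k : piecewise_poly T (fun x => A i j k * (W i x * partial k (W j) x)).
  by apply: piecewise_polyM => //; exact: piecewise_polyC.
have -> : inner (A_grad A w) w = \sum_i \sum_j \sum_k A i j k * S i j k.
  transitivity (integral_Rd Omega (fun x => \sum_i \sum_j \sum_k
      A i j k * (W i x * partial k (W j) x))).
    congr integral_Rd; apply/funext => x; apply: eq_bigr => i _; rewrite mxE big_distrl.
    apply: eq_bigr => j _; rewrite big_distrl /=; apply: eq_bigr => k _.
    by rewrite -mulrA [_ * w x 0 i]mulrC.
  rewrite (integral_Rd_sum Omega_bounded T_mesh); last first.
    by move=> i; do 2 apply: piecewise_poly_sum => ?.
  apply: eq_bigr => i _; rewrite (integral_Rd_sum Omega_bounded T_mesh); last first.
    by move=> j; apply: piecewise_poly_sum => ?.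
  apply: eq_bigr => j _; rewrite (integral_Rd_sum Omega_bounded T_mesh) //.
  by apply: eq_bigr => k _; rewrite (integral_RdZ Omega_bounded T_mesh).
have S_skew i j k : S j i k = - S i j k.
  apply/eqP; rewrite -addr_eq0; apply/eqP; rewrite /S -(integral_RdD Omega_bounded T_mesh) //.
  pose f x := W i x * W j x.
  have cf : {within closure Omega, continuous f}.
    move/subspace_continuousP : cw => cw; apply/subspace_continuousP => x clx.
    have cW l : W l y @[y --> within (closure Omega) (nbhs x)] --> W l x.
      apply: (cvg_comp w (fun v : 'rV[R]_m => v 0 l) (cw x clx)).
      exact: coord_continuous.
    exact: cvgM (cW i) (cW j).
  have pf : poly_on_simplices T f.
    move=> K; have [p hp] := cg_poly_on_simplices wcg i K.
    have [q hq] := cg_poly_on_simplices wcg j K.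
    by exists (p * q) => x xK; rewrite polyfunM /f /W hp ?hq.
  rewrite -[RHS](_ : integral_Rd Omega (partial k f) = 0).
    apply: (eq_integral_Rd T_mesh) => x [K _ xK].
    have [p hp] := pw i K; have [q hq] := pw j K.
    have oK := @open_simplex_inside R d (T K).
    rewrite (partial_poly k oK xK hp) (partial_poly k oK xK hq).
    rewrite (@partial_poly _ _ _ f (p * q) k x oK xK); last first.
      by move=> y yK; rewrite polyfunM /f /W hp ?hq.
    by rewrite mpoly.mderivM polyfunD !polyfunM /= /W hp ?hq // [X in X + _]mulrC.
  case: bc => [[a [b [ab OE LE]]]|w0].
    apply: (integral_partial_periodic Omega_bounded T_mesh ab OE) => // x xO xO'.
    rewrite /f /W perw // LE; exists (fun j => (j == k)%:R) => l.
    rewrite !mxE eqxx /= mulrC; case: eqVneq => [->|_] /=; first by [].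
    by rewrite !mul0r.
  by apply: (integral_partial_vanishing Omega_open Omega_bounded T_mesh) => // x /w0 wx0;
    rewrite /f /W wx0 mxE mul0r.
set X := (X in X = 0).
suff : X = - X by move/eqP; rewrite -addr_eq0 -mulr2n mulrn_eq0 => /eqP.
rewrite {1}/X exchange_big /= -sumrN; apply: eq_bigr => i _; rewrite -sumrN.
apply: eq_bigr => j _; rewrite -sumrN; apply: eq_bigr => k _.
by rewrite S_skew A_sym mulrN.
Qed.

End Fields.

(** * Interpolation in the discontinuous space *)

Section Interpolation.
Context (R : fieldType) (Y I : Type) (D : set Y) (V : set (Y -> R)) (e : I -> Y -> R).
Hypothesis V_lin : forall c f g, V f -> V g -> V (fun y => f y - c * g y).
Hypothesis V_e : forall k, V (e k).

(** Membership in the span of the functions e k on D, one generator at a time to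
    match the induction below. *)
Fixpoint spanned (s : seq I) (f : Y -> R) : Prop :=
  if s is k :: s' then exists c, spanned s' (fun y => f y - c * e k y)
  else forall y, D y -> f y = 0.

Lemma spanned_sum (s : seq I) (c : I -> R) f :
  (forall y, D y -> f y = \sum_(k <- s) c k * e k y) -> spanned s f.
Proof.
elim: s f => [|k s IHs] f fE /=; first by move=> y /fE; rewrite big_nil.
exists (c k); apply: IHs => y Dy; rewrite fE // big_cons addrAC subrr add0r //.
Qed.

(** Adding a generator e k: let h be the error of interpolating it with the points
    found so far.  If h vanishes on D nothing changes; otherwise a point where it
    does not vanish is a new node, with h rescaled as its basis function. *)
Lemma spanned_interpolation (s : seq I) :
  exists r (X : 'I_r -> Y) (g : 'I_r -> Y -> R),
    [/\ forall l, D (X l), forall l, V (g l) &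
      forall f, spanned s f -> forall y, D y -> f y = \sum_l f (X l) * g l y].
Proof.
elim: s => [|k s [r [X [g [DX Vg gE]]]]].
  have X0 : 'I_0 -> Y by case.
  have g0 : 'I_0 -> Y -> R by case.
  by exists 0%N, X0, g0; split=> [[]//|[]//|f f0 y Dy]; rewrite big_ord0 f0.
pose h y := e k y - \sum_l e k (X l) * g l y.
have Vh : V h.
  rewrite /h; elim: (index_enum _) => [|l t IHt].
    by under eq_fun do rewrite big_nil subr0; exact: V_e.
  have := V_lin (e k (X l)) IHt (Vg l); congr V; apply/funext => y.
  by rewrite big_cons opprD addrA addrAC.
have hE c f : spanned s (fun y => f y - c * e k y) -> forall y, D y ->
    f y = \sum_l f (X l) * g l y + c * h y.
  move=> /gE fE y /fE; move/eqP; rewrite subr_eq => /eqP ->.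
  rewrite /h mulrBr addrA addrAC; congr (_ + _).
  rewrite mulr_sumr -sumrB; apply: eq_bigr => l _; ring.
case: (pselect (exists2 y0, D y0 & h y0 != 0)) => [[y0 Dy0 h0]|h0].
  pose X' (l : 'I_r.+1) := if unlift ord0 l is Some j then X j else y0.
  pose g' (l : 'I_r.+1) y := if unlift ord0 l is Some j then g j y - g j y0 / h y0 * h y
                             else (h y0)^-1 * h y.
  exists r.+1, X', g'; split.
  - by move=> l; rewrite /X'; case: unlift.
  - move=> l; rewrite /g'; case: unlift => [j|]; first exact: V_lin.
    have := V_lin (- (h y0)^-1) (V_lin 1 Vh Vh) Vh; congr V; apply/funext => y.
    by rewrite mul1r subrr sub0r mulNr opprK.
  - move=> f [c fs] y Dy; rewrite big_ord_recl /X' /g' unlift_none.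
    under eq_bigr do rewrite liftK.
    rewrite (hE c f fs y Dy).
    have -> : f y0 = \sum_l f (X l) * g l y0 + c * h y0 by exact: hE.
    rewrite [in RHS]mulrDl addrAC.
    have -> : c * h y0 * ((h y0)^-1 * h y) = c * h y by field.
    rewrite addrC [RHS]addrC; congr (_ + _).
    rewrite mulr_suml -big_split; apply: eq_bigr => l _ /=; field.
    exact: h0.
exists r, X, g; split=> // f [c fs] y Dy; rewrite (hE c f fs y Dy).
have -> : h y = 0; last by rewrite mulr0 addr0.
by apply/eqP; apply: contrapT => /negP hy; apply: h0; exists y.
Qed.

End Interpolation.

Section DGInterpolation.
Context (R : realType) (d m n : nat).
Variables (Omega Lambda : set 'rV[R]_d) (T : 'I_n -> 'M[R]_(d.+1, d)).
Hypothesis T_mesh : conforming_mesh Omega Lambda T.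

Lemma interior_simplex_inj K L x :
  interior (simplex (T K)) x -> interior (simplex (T L)) x -> K = L.
Proof.
move=> xK xL; apply/eqP; apply: contrapT => /negP KL.
by have := mesh_nonoverlapping T_mesh KL; rewrite -subset0 => /(_ x); apply.
Qed.

(** Fields are viewed as scalar functions of a point and a component index, which
    on the open simplices are combinations of the finitely many monomials of degree
    at most N, each supported by one simplex and one component. *)
Lemma dg_interpolation N :
  exists r (X : 'I_r -> 'rV[R]_d) (iota : 'I_r -> 'I_m) (phi : 'I_r -> 'rV[R]_d -> 'rV[R]_m),
    [/\ forall l, exists K, interior (simplex (T K)) (X l),
        forall l, dg_space T N (phi l) &
        forall v, dg_space T N v -> forall K x, interior (simplex (T K)) x ->
          v x = \sum_l v (X l) 0 (iota l) *: phi l x].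
Proof.
pose Y : Type := ('rV[R]_d * 'I_m)%type.
pose I : finType := (('I_n * 'I_m) * mpoly.bmultinom d N.+1)%type.
pose D : set Y := [set y | exists K, interior (simplex (T K)) y.1].
pose field_of (f : Y -> R) x : 'rV[R]_m := \row_i f (x, i).
pose V : set (Y -> R) := [set f | dg_space T N (field_of f)].
pose e (k : I) (y : Y) : R :=
  if (y.1 \in (interior (simplex (T k.1.1)) : set 'rV[R]_d)) && (k.1.2 == y.2)
  then polyfun (mpoly.mpolyX R (mpoly.bmnm k.2)) y.1 else 0.
have V_lin c f g : V f -> V g -> V (fun y => f y - c * g y).
  move=> Vf Vg K j; have [p sp fp] := Vf K j; have [q sq gq] := Vg K j.
  exists (p - c *: q).
    rewrite -scaleNr; apply: leq_trans (mpoly.mmeasureD_le _ _ _) _.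
    by rewrite geq_max sp (leq_trans (mpoly.msizeZ_le _ _)).
  move=> x xK; rewrite mxE mpoly.mevalB mpoly.mevalZ -fp // -gq //.
  by rewrite /field_of !mxE.
have V_e k : V (e k).
  case: k => [[K i] al] L j.
  have [[-> ->]|nKL] := pselect (K = L /\ i = j).
    exists (mpoly.mpolyX R (mpoly.bmnm al)).
      by rewrite mpoly.msizeX; exact: mpoly.bmdeg.
    by move=> x xL; rewrite mxE /e /= mem_set // eqxx.
  exists 0; first by rewrite mpoly.mmeasure0.
  move=> x xL; rewrite mxE mpoly.meval0 /e /=; case: ifP => // /andP[/set_mem xK /eqP ij].
  by exfalso; apply: nKL; split=> //; exact: interior_simplex_inj xK xL.
have [r [X [g [DX Vg gE]]]] := spanned_interpolation D V_lin V_e (enum I).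
exists r, (fun l => (X l).1), (fun l => (X l).2), (fun l => field_of (g l)).
split=> // v vdg K x xK; apply/rowP => i; rewrite summxE.
have vs : spanned D e (enum I) (fun y => v y.1 0 y.2).
  have H Ki : exists p : mpoly.mpoly d R, (mpoly.msize p <= N.+1)%N /\
      forall y, interior (simplex (T Ki.1)) y -> v y 0 Ki.2 = polyfun p y.
    by have [p sp vp] := vdg Ki.1 Ki.2; exists p.
  have [p hp] := choice H.
  apply: (@spanned_sum R Y I D e (enum I) (fun k => mpoly.mcoeff (mpoly.bmnm k.2) (p k.1))).
  move=> [y j] [L yL] /=; rewrite big_enum /=.
  rewrite -(pair_bigA _ (fun Ki al => mpoly.mcoeff (mpoly.bmnm al) (p Ki) * e (Ki, al) (y, j))) /=.
  rewrite (bigD1 (L, j)) //= [X in _ + X]big1 ?addr0; last first.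
    move=> [L' j'] neq; apply: big1 => al _; rewrite /e /=.
    case: ifP => [/andP[/set_mem yL' /eqP jj']|]; last by rewrite mulr0.
    by move: neq; rewrite jj' (interior_simplex_inj yL yL') eqxx.
  rewrite ((hp (L, j)).2 y yL) [in LHS](mpoly.mpolywE (hp (L, j)).1) polyfun_sum.
  apply: eq_bigr => al _; rewrite /e /= mem_set // eqxx /=.
  by rewrite -mpoly.mul_mpolyC polyfunM polyfunC.
rewrite (gE _ vs (x, i)); last by exists K.
by apply: eq_bigr => l _; rewrite !mxE.
Qed.

End DGInterpolation.

(** * Derivatives in time *)

Section RealDerivatives.
Context (R : realType).

(** P and Q are o(s - t), hence so is the increment of F. *)
Lemma is_derive0_squeeze (F P Q : R -> R) (t : R) :
  P t = 0 -> Q t = 0 -> is_derive t 1 P 0 -> is_derive t 1 Q 0 ->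
  (\forall s \near t, `|F s - F t| <= `|P s| + `|Q s|) -> is_derive t 1 F 0.
Proof.
move=> Pt Qt [dP P0] [dQ Q0] /nbhs_ballP [r r0 FPQ].
have quot (G : R -> R) : G t = 0 -> derivable G t 1 -> 'D_1 G t = 0 ->
    forall e, 0 < e -> \forall h \near 0^', `|G (h *: 1 + t)| < e * `|h|.
  move=> Gt dG G0 e e0; have : h^-1 *: (G (h *: 1 + t) - G t) @[h --> 0^'] --> (0 : R).
    move: dG => /cvg_ex[l Gl]; have l0 : l = 0.
      by rewrite -G0; apply/esym/cvg_lim => //; exact: Gl.
    by rewrite l0 in Gl; exact: Gl.
  move/cvgr0Pnorm_lt/(_ e e0) => H; near=> h.
  have h0 : h != 0 by near: h; exact: nbhs_dnbhs_neq.
  have : `|h^-1 *: (G (h *: 1 + t) - G t)| < e by near: h.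
  by rewrite Gt subr0 normrZ normfV mulrC ltr_pdivrMr // normr_gt0.
have F0 : h^-1 *: (F (h *: 1 + t) - F t) @[h --> 0^'] --> (0 : R).
  apply/cvgr0Pnorm_lt => e e0; have e20 : 0 < e / 2 by rewrite divr_gt0.
  near=> h.
  have h0 : h != 0 by near: h; exact: nbhs_dnbhs_neq.
  rewrite normrZ normfV mulrC ltr_pdivrMr ?normr_gt0 //.
  apply: le_lt_trans (FPQ _ _) _.
    rewrite -ball_normE /= [h *: 1]mulr1 opprD addrCA subrr addr0 normrN.
    by near: h; exact: dnbhs0_lt.
  rewrite [e]splitr mulrDl; apply: ltrD; near: h; exact: quot.
by apply: DeriveDef; [exact: cvgP F0 | exact: cvg_lim F0].
Unshelve. all: by end_near. Qed.

Lemma is_derive_lin_comb r (c : 'I_r -> R -> R) (dc a : 'I_r -> R) (t : R) :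
  (forall l, is_derive t 1 (c l) (dc l)) ->
  is_derive t 1 (fun s => \sum_l c l s * a l) (\sum_l dc l * a l).
Proof.
move=> dcE; rewrite (_ : (fun s => _) = \sum_l (fun s => c l s * a l)); last first.
  by apply/funext => s; rewrite fct_sumE.
apply: is_derive_sum => l.
apply: (@is_derive_eq _ _ _ (c l * cst (a l))).
by rewrite scaler0 add0r [LHS]mulrC.
Qed.

Lemma is_derive_subr_cst (c : R -> R) (dc k t : R) :
  is_derive t 1 c dc -> is_derive t 1 (fun s => c s - k) dc.
Proof.
move=> dcE; apply: (@is_derive_eq _ _ _ (c - cst k)).
by rewrite subr0.
Qed.

Lemma is_derive_mul_null (f g : R -> R) (df dg t : R) :
  f t = 0 -> g t = 0 -> is_derive t 1 f df -> is_derive t 1 g dg ->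
  is_derive t 1 (fun s => f s * g s) 0.
Proof.
move=> ft gt dfE dgE; apply: (@is_derive_eq _ _ _ (f * g)).
by rewrite ft gt !scale0r addr0.
Qed.

Lemma derive1_row_lin_comb r k (c : 'I_r -> R -> R) (dc : 'I_r -> R) (a : 'I_r -> 'rV[R]_k)
    (u : R -> 'rV[R]_k) (t : R) :
  (forall l, is_derive t 1 (c l) (dc l)) ->
  (\forall s \near t, u s = \sum_l c l s *: a l) ->
  derive1 u t = \sum_l dc l *: a l.
Proof.
move=> dcE uE; pose v s := \sum_l c l s *: a l.
have dv i : is_derive t 1 (fun s => v s 0 i) (\sum_l dc l * a l 0 i).
  rewrite (_ : (fun s => _) = fun s => \sum_l c l s * a l 0 i).
    exact: is_derive_lin_comb.
  by apply/funext => s; rewrite /v summxE; apply: eq_bigr => l _; rewrite mxE.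
have derv : derivable v t 1 by apply/derivable_mxP => i j; rewrite ord1; case: (dv j).
rewrite derive1E (near_eq_derive _ uE) derive_mx //.
apply/rowP => i; rewrite mxE summxE; case: (dv i) => _ ->.
by apply: eq_bigr => l _; rewrite mxE.
Qed.

End RealDerivatives.

(** * Energy conservation *)

Section CGSpace.
Context (R : realType) (d m n : nat).
Variables (Omega Lambda : set 'rV[R]_d) (T : 'I_n -> 'M[R]_(d.+1, d)).

Lemma polynomial_on_lin N (D : set 'rV[R]_d) c (u v : 'rV[R]_d -> 'rV[R]_m) :
  polynomial_on N D u -> polynomial_on N D v -> polynomial_on N D (fun x => u x + c *: v x).
Proof.
move=> pu pv j; have [p sp up] := pu j; have [q sq vq] := pv j.
exists (p + c *: q).
  apply: leq_trans (mpoly.mmeasureD_le _ _ _) _.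
  by rewrite geq_max sp (leq_trans (mpoly.msizeZ_le _ _)).
by move=> x xD; rewrite mpoly.mevalD mpoly.mevalZ -up // -vq // !mxE.
Qed.

Lemma cg_spaceB N (u v : 'rV[R]_d -> 'rV[R]_m) :
  cg_space T Omega Lambda N u -> cg_space T Omega Lambda N v ->
  cg_space T Omega Lambda N (fun x => u x - v x).
Proof.
move=> [cu pu peru] [cv pv perv]; split.
- by move=> x; apply: continuousB; [exact: cu | exact: cv].
- move=> K; have -> : (fun x => u x - v x) = (fun x => u x + (-1) *: v x).
    by apply/funext => x; rewrite scaleN1r.
  exact: polynomial_on_lin.
- by move=> x tau *; rewrite peru ?perv.
Qed.

Lemma dg_space_lin N c (u v : 'rV[R]_d -> 'rV[R]_m) : dg_space T N u -> dg_space T N v ->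
  dg_space T N (fun x => u x + c *: v x).
Proof. by move=> du dv K; exact: polynomial_on_lin. Qed.

Lemma dg_space_lin_comb N r (c : 'I_r -> R) (phi : 'I_r -> 'rV[R]_d -> 'rV[R]_m) :
  (forall l, dg_space T N (phi l)) -> dg_space T N (fun x => \sum_l c l *: phi l x).
Proof.
move=> dphi; elim: (index_enum _) => [|l s IHs].
  under eq_fun do rewrite big_nil; move=> K j.
  by exists 0; [rewrite mpoly.mmeasure0 | move=> x _; rewrite mpoly.meval0 mxE].
under eq_fun do rewrite big_cons addrC; exact: dg_space_lin.
Qed.

Lemma eq_dg_space N (u v : 'rV[R]_d -> 'rV[R]_m) :
  (forall K x, interior (simplex (T K)) x -> u x = v x) -> dg_space T N u -> dg_space T N v.
Proof.
by move=> uv du K j; have [p sp up] := du K j; exists p => // x xK; rewrite -(uv K) ?up.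
Qed.

End CGSpace.

Theorem lemma3 (R : realType) (d m n N : nat)
  (A : 'I_m -> 'I_m -> 'I_d -> R)
  (Omega Lambda : set 'rV[R]_d) (T : 'I_n -> 'M[R]_(d.+1, d))
  (J : set R) (u w : R -> 'rV[R]_d -> 'rV[R]_m)
  (A_sym : forall i j k, A i j k = A j i k)
  (Omega_open : open Omega) (Omega_bounded : bounded_set Omega)
  (T_mesh : conforming_mesh Omega Lambda T)
  (J_open : open J)
  (u_solution : semidiscrete_solution T A Omega N J u w)
  (w_projection : forall t, J t ->
    is_L2_projection Omega (cg_space T Omega Lambda N.+1) (u t) (w t))
  (boundary_conditions :
    periodic_box Omega Lambda \/
    (Lambda = [set 0] /\
     forall t, J t -> forall x, boundary Omega x -> w t x = 0)) :
  forall t, J t -> is_derive t 1 (fun s => 2^-1 * L2_norm Omega (w s) ^+ 2) 0.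
Proof.
move=> t Jt; pose inner (v v' : 'rV[R]_d -> 'rV[R]_m) := L2_inner Omega v v'.
have [sol_dg sol_der sol_weak] := u_solution.
have Wcg s : J s -> cg_space T Omega Lambda N.+1 (w s) by move=> /w_projection [].
have ppW s : J s -> piecewise_poly_field T (w s).
  by move=> Js; exact: (cg_piecewise_poly T_mesh (Wcg s Js)).
have ppU s : J s -> piecewise_poly_field T (u s).
  by move=> Js; exact: (dg_piecewise_poly T_mesh (sol_dg s Js)).
have innerB := @L2_innerBl R d m n Omega Lambda T Omega_bounded T_mesh.
have innerD := @L2_innerDl R d m n Omega Lambda T Omega_bounded T_mesh.
have innerZ := @L2_innerZl R d m n Omega Lambda T Omega_bounded T_mesh.
have innerC := @L2_innerC R d m Omega.
have [r [X [iota [phi [Xin dphi interp]]]]] := dg_interpolation m T_mesh N.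
have ppphi l : piecewise_poly_field T (phi l).
  exact: (dg_piecewise_poly T_mesh (dphi l)).
pose c l s := u s (X l) 0 (iota l).
pose dc l := 'D_1 (c l) t.
have c_derive l : is_derive t 1 (c l) (dc l).
  apply: DeriveDef => //; have [K XK] := Xin l.
  have /derivable_mxP := sol_der t Jt K (X l) XK.
  by move/(_ 0 (iota l)).
have uE s K x : J s -> interior (simplex (T K)) x -> u s x = \sum_l c l s *: phi l x.
  by move=> Js xK; exact: interp (sol_dg s Js) K x xK.
have J_near : \forall s \near t, J s by exact: open_nbhs_nbhs.
have dtE K x : interior (simplex (T K)) x ->
    \sum_l dc l *: phi l x = time_derivative u t x.
  move=> xK; apply/esym.
  apply: (derive1_row_lin_comb (a := fun l => phi l x) (u := fun s => u s x) c_derive).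
  by near=> s; apply: (uE s K) => //; near: s.
have dt_dg : dg_space T N (time_derivative u t).
  exact: eq_dg_space dtE (dg_space_lin_comb dc dphi).
have Ag_dg : dg_space T N (A_grad A (w t)) by exact: dg_A_grad (Wcg t Jt).
have pp_dt := dg_piecewise_poly T_mesh dt_dg.
have pp_Ag := dg_piecewise_poly T_mesh Ag_dg.
pose res x := time_derivative u t x + A_grad A (w t) x.
have res_dg : dg_space T N res.
  have -> : res = (fun x => time_derivative u t x + 1 *: A_grad A (w t) x).
    by apply/funext => x; rewrite scale1r.
  exact: dg_space_lin.
have pp_res := dg_piecewise_poly T_mesh res_dg.
(* The residual is its own test function. *)
have res0 : inner res res = 0 by rewrite /inner innerD //; exact: sol_weak.
have Ag_w : inner (A_grad A (w t)) (w t) = 0.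
  apply: (A_grad_inner_eq0 Omega_open Omega_bounded T_mesh A_sym (Wcg t Jt)).
  by case: boundary_conditions => [|[_ w0]]; [left | right => x; exact: w0].
have dt_w : inner (time_derivative u t) (w t) = 0.
  have := L2_inner_null Omega_bounded T_mesh pp_res (ppW t Jt) res0.
  rewrite [X in X = 0 -> _](innerD _ _ _ pp_dt pp_Ag (ppW t Jt)).
  by rewrite -/(inner _ (w t)) -/(inner (A_grad _ _) _) Ag_w addr0.
have inner_sum (a : 'I_r -> R) v : piecewise_poly_field T v ->
    inner (fun x => \sum_l a l *: phi l x) v = \sum_l a l * inner (phi l) v.
  move=> pv; have ppZ l : piecewise_poly_field T (fun x => a l *: phi l x).
    exact: piecewise_polyZ_field.
  suff [] : piecewise_poly_field T (fun x => \sum_l a l *: phi l x) /\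
    inner (fun x => \sum_l a l *: phi l x) v = \sum_l a l * inner (phi l) v by [].
  elim: (index_enum _) => [|l ls [ppls IHls]].
    have -> : (fun x => \sum_(l <- [::]) a l *: phi l x) = (fun x => 0 *: v x).
      by apply/funext => x; rewrite big_nil scale0r.
    split; first exact: piecewise_polyZ_field.
    by rewrite big_nil /inner innerZ // mul0r.
  under eq_fun do rewrite big_cons; split; first exact: piecewise_polyD_field.
  by rewrite big_cons /inner innerD // innerZ // -IHls.
have u_diff s : J s -> forall v, piecewise_poly_field T v ->
    inner (fun x => u s x - u t x) v = \sum_l (c l s - c l t) * inner (phi l) v.
  move=> Js v pv; rewrite -inner_sum //; apply: (eq_L2_inner T_mesh) => x [K _ xK].
  have xK' : interior (simplex (T K)) x.
    by apply: simplex_inside_interior => //; exact: mesh_nondegenerate T_mesh _.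
  rewrite (uE s K) // (uE t K) // -sumrB; apply: eq_bigr => l _.
  by rewrite scalerBl.
(* P is the linear part of the energy increment, Q its quadratic bound. *)
pose P s := \sum_l (c l s - c l t) * inner (phi l) (w t).
pose Q s := \sum_l \sum_l' (c l s - c l t) * (c l' s - c l' t) * inner (phi l') (phi l).
have bound s : J s -> `|2^-1 * L2_norm Omega (w s) ^+ 2 - 2^-1 * L2_norm Omega (w t) ^+ 2|
    <= `|P s| + `|Q s|.
  move=> Js; pose dw x := w s x - w t x; pose du x := u s x - u t x.
  have pp_dw : piecewise_poly_field T dw.
    exact: (cg_piecewise_poly T_mesh (cg_spaceB (Wcg s Js) (Wcg t Jt))).
  have pp_du : piecewise_poly_field T du.
    by apply: piecewise_polyB_field; exact: ppU.
  have proj s' v : J s' -> cg_space T Omega Lambda N.+1 v -> inner (w s') v = inner (u s') v.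
    move=> Js' vW; have [_ /(_ v vW)] := w_projection s' Js'.
    have pv := cg_piecewise_poly T_mesh vW.
    rewrite (innerB _ _ _ (ppU s' Js') (ppW s' Js') pv) => /eqP.
    by rewrite subr_eq0 => /eqP.
  have dwdu v : cg_space T Omega Lambda N.+1 v -> inner dw v = inner du v.
    move=> vW; have pv := cg_piecewise_poly T_mesh vW.
    rewrite /inner (innerB _ _ _ (ppW s Js) (ppW t Jt) pv).
    rewrite (innerB _ _ _ (ppU s Js) (ppU t Jt) pv).
    by rewrite -!/(inner _ _) !proj.
  have dwE := dwdu dw (cg_spaceB (Wcg s Js) (Wcg t Jt)).
  have PE : inner dw (w t) = P s by rewrite dwdu ?u_diff //; [exact: ppW | exact: Wcg].
  have QE : inner du du = Q s.
    rewrite u_diff //; apply: eq_bigr => l _.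
    rewrite [inner (phi l) du]innerC -[L2_inner _ _ _]/(inner du (phi l)) u_diff // big_distrr.
    by apply: eq_bigr => l' _; rewrite /= mulrA.
  have dw_ge0 : 0 <= inner dw dw by exact: L2_inner_ge0.
  have dw_le : inner dw dw <= inner du du.
    have := L2_inner_ge0 Omega (fun x => du x - dw x).
    rewrite (L2_inner_sqrB Omega_bounded T_mesh pp_du pp_dw).
    rewrite -!/(inner _ _) -dwE; lra.
  have expand : inner (w s) (w s) - inner (w t) (w t) = P s *+ 2 + inner dw dw.
    rewrite -PE /inner (L2_inner_sqrB Omega_bounded T_mesh (ppW s Js) (ppW t Jt)).
    rewrite (innerB _ _ _ (ppW s Js) (ppW t Jt) (ppW t Jt)); ring.
  rewrite !L2_norm_sqr -mulrBr expand -QE.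
  have -> : 2^-1 * (P s *+ 2 + inner dw dw) = P s + 2^-1 * inner dw dw by field.
  apply: le_trans (ler_normD _ _) _; rewrite lerD2l.
  rewrite !ger0_norm //; [lra | exact: le_trans dw_le | by rewrite mulr_ge0].
have dP : is_derive t 1 P (\sum_l dc l * inner (phi l) (w t)).
  by apply: is_derive_lin_comb => l; exact: is_derive_subr_cst (c_derive l).
have dP0 : \sum_l dc l * inner (phi l) (w t) = 0.
  rewrite -inner_sum; last exact: ppW.
  rewrite -[RHS]dt_w; apply: (eq_L2_inner T_mesh) => x [K _ xK].
  apply: (dtE K); apply: simplex_inside_interior => //.
  exact: mesh_nondegenerate T_mesh _.
apply: (@is_derive0_squeeze R _ P Q).
- by rewrite /P big1 // => l _; rewrite subrr mul0r.
- by rewrite /Q big1 // => l _; rewrite big1 // => l' _; rewrite subrr !mul0r.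
- by rewrite -dP0.
- have -> : Q = \sum_l (fun s =>
      \sum_l' (c l s - c l t) * (c l' s - c l' t) * inner (phi l') (phi l)).
    by apply/funext => s; rewrite fct_sumE.
  apply: (is_derive_eq (f' := \sum_(l < r) 0)); last by rewrite big1.
  apply: is_derive_sum => l.
  apply: (is_derive_eq (f' := \sum_(l' < r) 0 * inner (phi l') (phi l))); last first.
    by rewrite big1 // => l' _; rewrite mul0r.
  apply: is_derive_lin_comb => l'.
  by apply: is_derive_mul_null; rewrite ?subrr //; exact: is_derive_subr_cst (c_derive _).
- by near=> s; apply: bound; near: s.
Unshelve. all: by end_near. Qed.
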